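(* Let $\mathcal H$ be any Birkhoff decomposable subgroup of $\Lambda G$, let $U$ be a manifold, and let $a,b\in\mathbb Z\cup\{\pm\infty\}$ with $a<0<b$. To every $F\in\mathcal B\mathcal H(U)_a^b$ there corresponds a unique pair $$G_-\in\mathcal H(U)_a^{-1},\qquad F_+\in\mathcal H(U)_1^b,$$ with $F_+$ taking values in $\mathcal H_1^+$ and $G_-$ taking values in $\mathcal H_1^-$ (that is, normalized by $F_+|_{\lambda=0}=I$, $G_-|_{\lambda=\infty}=I$), such that $$F=F_+F_-=G_-G_+$$ for some $F_-\in\mathcal H^-(U)$ and $G_+\in\mathcal H^+(U)$. If $F$ is assumed to be based at $t_0\in U$, then $F_+$, $F_-$, $G_+$ and $G_-$ are also based at $t_0$.
   Context: Loop groups. $G$ is a connected complex semisimple matrix Lie group, with a matrix norm satisfying $\|AB\|\le\|A\|\|B\|$, $\|I\|=1$. $\Lambda G$ is the Banach Lie group of maps $g=\sum_{i\in\mathbb Z} g_i\lambda^i:\mathbb S^1\to G$ with $\|g\|:=\sum\|g_i\|<\infty$. $\mathbb D_+$ is the open unit disc and $\mathbb D_-$ the complement of its closure in the Riemann sphere; $\Lambda^\pm G$ is the subgroup of loops extending holomorphically to maps $\mathbb D_\pm\to G$; $\Lambda^+_1G$ (resp. $\Lambda^-_1G$) is the subgroup of $\Lambda^+G$ (resp. $\Lambda^-G$) of loops with $g(0)=I$ (resp. $g(\infty)=I$). All subgroups of $\Lambda G$ are assumed to be Banach Lie subgroups (closed submanifolds with the induced topology). For a subgroup $\mathcal H\subset\Lambda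 G$: $\mathcal H^\pm=\mathcal H\cap\Lambda^\pm G$, $\mathcal H_1^\pm=\mathcal H\cap\Lambda_1^\pm G$, and $\mathcal H^\circ=\mathcal H\cap\Lambda^+G\cap\Lambda^-G=\mathcal H\cap G$ (constant loops). $(X)_I$ is the identity component of $X$. Birkhoff decomposability. A Banach Lie group $\mathcal H$ together with connected Banach Lie subgroups $\mathcal H_1^{\pm}$ and $\mathcal H^\circ$ is called Birkhoff decomposable if $\mathcal{RB}\mathcal H:=\mathcal H_1^+\cdot\mathcal H^\circ\cdot\mathcal H_1^-$ and $\mathcal{LB}\mathcal H:=\mathcal H_1^-\cdot\mathcal H^\circ\cdot\mathcal H_1^+$ are open and dense in $(\mathcal H)_I$ and the multiplication maps $\mathcal H_1^+\times\mathcal H^\circ\times\mathcal H_1^-\to\mathcal{RB}\mathcal H$ and $\mathcal H_1^-\times\mathcal H^\circ\times\mathcal H_1^+\to\mathcal{LB}\mathcal H$ are analytic diffeomorphisms. A Banach Lie subgroup $\mathcal H\subset\Lambda G$ is a Birkhoff decomposable subgroup if the identity components of $\mathcal H\cap\Lambda_1^+G$, $\mathcal H\cap\Lambda_1^-G$ and $\mathcal H\cap\Lambda^+G\cap\Lambda^-G$ are closed Banach Lie subgroups and make $\mathcal H$ a Birkhoff decomposable group. The (central) big cell is $\mathcal B\mathcal H:=\mathcal{LB}\mathcal H\cap\mathcal{RB}\mathcal H$. Connection order. $\mathcal H(U)$ is the set of smooth maps $F:U\to\mathcal H$; similarly $\mathcal H^\pm(U)$. $F$ is based at $t_0$ if $F(t_0)=I$.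 For extended integers $a\le b$, $\mathcal H(U)_a^b$ is the set of $F\in\mathcal H(U)$ of connection order $(_a^b)$, i.e. whose Maurer-Cartan form has Fourier expansion $F^{-1}\mathrm dF=\sum_{i=a}^b A_i\lambda^i$. $\mathcal B\mathcal H(U)_a^b$ is the subset of those $F$ with $F(t)\in\mathcal B\mathcal H$ for all $t\in U$. *)

(* Defs.v *)
From HB Require Import structures.
From mathcomp Require Import all_boot all_order all_algebra.
From mathcomp Require Import complex.
From mathcomp Require Import all_classical all_reals all_analysis.

Set Implicit Arguments.
Unset Strict Implicit.
Unset Printing Implicit Defensive.

Import Order.TTheory GRing.Theory Num.Theory.
Import numFieldNormedType.Exports.

Local Open Scope classical_set_scope.
Local Open Scope ring_scope.
Local Open Scope complex_scope.

(* C^k by iterating the tangent map (x, v) |-> df_x(v).  Requiring all k gives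
   the usual Fréchet C^oo maps.  The set [A] is meant to be open. *)
Fixpoint Ck (R : realType) (k : nat) :
    forall E F : normedModType R, set E -> (E -> F) -> Prop :=
  match k with
  | 0 => fun E F A f => forall x, A x -> {for x, continuous f}
  | k'.+1 => fun E F A f =>
      (forall x, A x -> differentiable f x) /\
      @Ck R k' (E * E)%type F (A `*` setT) (fun p => 'd f (p.1) (p.2))
  end.

Definition smooth_on (R : realType) (E F : normedModType R)
  (A : set E) (f : E -> F) := forall k, Ck k A f.

(* The k-th homogeneous Taylor polynomial of f at x, D^k f(x)(h, ..., h) / k!,
   computed along the line through x with direction h. *)
Definition taylor_term (R : realType) (E F : normedModType R)
    (f : E -> F) (x : E) (k : nat) (h : E) : F :=
  (k`!%:R)^-1 *: derive1n k (fun t : R => f (x + t *: h)) 0.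

(* Smooth and, near each point, equal to its normally convergent Taylor
   series. *)
Definition analytic_on (R : realType) (E F : normedModType R)
    (A : set E) (f : E -> F) :=
  smooth_on A f /\
  forall x, A x -> exists (r M : R), [/\ 0 < r,
    (forall k h, `|taylor_term f x k h| <= M * (`|h| / r) ^+ k) &
    (forall h, `|h| < r ->
       series (fun k => taylor_term f x k h) @ \oo --> f (x + h))].

(* Real-analytic split submanifold: near p an analytic change of coordinates
   phi of E (with inverse psi) straightens M to the range of a continuous linear
   projection pi. *)
Definition analytic_submanifold (R : realType) (E : normedModType R)
    (M : set E) :=
  forall p, M p ->
  exists (V : set E) (phi psi : E -> E) (pi : {linear E -> E}),
  [/\ open V /\ V p,
      open (phi @` V),
      [/\ analytic_on V phi, analytic_on (phi @` V) psi &
          forall x, V x -> psi (phi x) = x],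
      continuous pi /\ (forall x, pi (pi x) = pi x) &
      forall x, V x -> (M x <-> pi (phi x) = phi x)].

(* Analyticity on an embedded submanifold: local analytic extendability to the
   ambient space. *)
Definition analytic_along (R : realType) (E F : normedModType R)
    (M : set E) (f : E -> F) :=
  forall p, M p -> exists (V : set E) (g : E -> F),
    [/\ open V, V p, analytic_on V g & forall x, V x -> M x -> f x = g x].

Definition analytic_diffeo (R : realType) (E F : normedModType R)
    (M : set E) (N : set F) (f : E -> F) :=
  [/\ set_bij M N f, analytic_along M f &
      exists g : F -> E, (forall x, M x -> g (f x) = x) /\ analytic_along N g].

Record manifold (R : realType) := Manifold {
  mcarrier :> topologicalType;
  mdim : nat;
  mindex : Type;
  mdom : mindex -> set mcarrier;
  mchart : mindex -> mcarrier -> 'rV[R]_mdim;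
  mparam : mindex -> 'rV[R]_mdim -> mcarrier;
  m_hausdorff : hausdorff_space mcarrier;
  m_countable : @second_countable mcarrier;
  m_cover : forall t, exists i, mdom i t;
  m_open_dom : forall i, open (mdom i);
  m_open_image : forall i, open (mchart i @` mdom i);
  m_chartK : forall i t, mdom i t -> mparam i (mchart i t) = t;
  m_chart_continuous : forall i t, mdom i t -> {for t, continuous (mchart i)};
  m_param_continuous : forall i x, (mchart i @` mdom i) x ->
    {for x, continuous (mparam i)};
  m_transition : forall i j,
    smooth_on (mchart i @` (mdom i `&` mdom j)) (mchart j \o mparam i) }.

Definition smooth_map (R : realType) (U : manifold R) (F : normedModType R)
    (f : U -> F) :=
  forall i, smooth_on (mchart i @` mdom i) (f \o @mparam R U i).

Record matrix_norm (R : realType) (n : nat) := MatrixNorm {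
  mxn :> 'M[R[i]]_n -> R;
  mxn_triangle : forall A B, mxn (A + B) <= mxn A + mxn B;
  mxn_scale : forall c A, mxn (c *: A) = complex.Re `|c| * mxn A;
  mxn_eq0 : forall A, mxn A = 0 -> A = 0;
  mxn_mul : forall A B, mxn (A *m B) <= mxn A * mxn B;
  mxn_1 : mxn 1%:M = 1 }.

(* Complex matrices as a real normed space, with norm nu. *)
Definition mat (R : realType) (n : nat) (nu : matrix_norm R n) := 'M[R[i]]_n.

Section MatInstances.
Context (R : realType) (n : nat) (nu : matrix_norm R n).

HB.instance Definition _ := GRing.PzRing.on (mat nu).

Definition cscale (c : R[i]) (A : mat nu) : mat nu := c *: (A : 'M[R[i]]_n).

Let rscale (a : R) (A : mat nu) : mat nu := cscale a%:C A.

Let rscaleA a b A : rscale a (rscale b A) = rscale (a * b) A.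
Proof. by rewrite /rscale /cscale scalerA rmorphM. Qed.
Let rscale1 : left_id 1 rscale.
Proof. by move=> A; rewrite /rscale /cscale rmorph1 scale1r. Qed.
Let rscaleDr : right_distributive rscale +%R.
Proof. by move=> a A B; rewrite /rscale /cscale scalerDr. Qed.
Let rscaleDl A : {morph rscale^~ A : a b / a + b}.
Proof. by move=> a b; rewrite /rscale /cscale rmorphD scalerDl. Qed.

HB.instance Definition _ := GRing.Zmodule_isLmodule.Build R (mat nu)
  rscaleA rscale1 rscaleDr rscaleDl.

Let norm_rscale (a : R) (A : mat nu) : nu (a *: A) = `|a| * nu A.
Proof.
rewrite [a *: A]/(cscale a%:C A) /cscale mxn_scale.
by congr (_ * _); rewrite normc_def /= expr0n /= addr0 sqrtr_sqr.
Qed.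

HB.instance Definition _ := Lmodule_isNormed.Build R (mat nu)
  (@mxn_triangle _ _ nu) norm_rscale (@mxn_eq0 _ _ nu).

End MatInstances.

Section MatrixGroups.
Context (R : realType) (n : nat) (nu : matrix_norm R n).
Implicit Types G g a : set (mat nu).

Definition GL : set (mat nu) := [set A | (A : 'M[R[i]]_n) \in unitmx].

Definition matrix_group G :=
  [/\ G `<=` GL, G 1, (forall A B, G A -> G B -> G (A * B)),
      (forall A, G A -> G (invmx (A : 'M[R[i]]_n))) & closure G `&` GL `<=` G].

Definition mexp (X : mat nu) : mat nu :=
  limn (series (fun k => (k`!%:R : R)^-1 *: X ^+ k)).

(* Lie algebra of a closed matrix group: generators of its one-parameter
   subgroups. *)
Definition lie_algebra G : set (mat nu) :=
  [set X | forall t : R, G (mexp (t *: X))].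

Definition mbracket (X Y : mat nu) : mat nu := X * Y - Y * X.

Definition complex_subspace a :=
  [/\ a 0, (forall X Y, a X -> a Y -> a (X + Y)) &
      (forall c X, a X -> a (cscale c X))].

Definition lie_ideal g a :=
  [/\ a `<=` g, complex_subspace a &
      forall X Y, g X -> a Y -> a (mbracket X Y)].

(* [a, a]; for a subspace [a] the sums of brackets are its linear span. *)
Definition derived a : set (mat nu) :=
  [set X | exists m (S T : 'I_m -> mat nu),
     (forall i, a (S i) /\ a (T i)) /\ X = \sum_i mbracket (S i) (T i)].

Definition lie_solvable a := exists m, iter m derived a `<=` [set 0].

Definition lie_semisimple g :=
  forall a, lie_ideal g a -> lie_solvable a -> a `<=` [set 0].

Definition complex_semisimple_group G :=
  [/\ matrix_group G, connected G, complex_subspace (lie_algebra G) &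
      lie_semisimple (lie_algebra G)].

End MatrixGroups.

Record wiener (R : realType) (n : nat) (nu : matrix_norm R n) := Wiener {
  fcoef :> int -> mat nu;
  fcoefP : summable setT (fun i => `|fcoef i|%:E) }.

Section WienerInstances.
Context (R : realType) (n : nat) (nu : matrix_norm R n).
Implicit Types f g : wiener nu.

Lemma wienerP f g : fcoef f =1 fcoef g -> f = g.
Proof.
case: f g => [f fP] [g gP] /= /funext fg; subst g.
by congr Wiener; exact: Prop_irrelevance.
Qed.

HB.instance Definition _ := gen_eqMixin (wiener nu).
HB.instance Definition _ := gen_choiceMixin (wiener nu).

Lemma summable_nonneg (u : int -> R) : (forall i, 0 <= u i) ->
  summable setT (fun i => (u i)%:E) =
  (\esum_(i in setT) (u i)%:E < +oo)%E :> Prop.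
Proof.
move=> u0; rewrite /summable; congr (is_true (_ < _)%E).
by apply: eq_esum => i _; rewrite gee0_abs// lee_fin.
Qed.

Lemma wiener_fin f : (\esum_(i in setT) `|f i|%:E < +oo)%E.
Proof. by have := fcoefP f; rewrite summable_nonneg. Qed.

Lemma summable_dominated (u v : int -> R) : (forall i, 0 <= u i <= v i) ->
  (\esum_(i in setT) (v i)%:E < +oo)%E -> summable setT (fun i => (u i)%:E).
Proof.
move=> uv vfin; rewrite summable_nonneg; last by move=> i; case/andP: (uv i).
by apply: le_lt_trans vfin; apply: le_esum => i _; rewrite lee_fin;
  case/andP: (uv i).
Qed.

Let zeroP : summable setT (fun i : int => `|0 : mat nu|%:E).
Proof.
rewrite summable_nonneg//.
by under eq_esum do rewrite normr0; rewrite esum1.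
Qed.
Definition wiener0 := Wiener zeroP.

Let addP f g : summable setT (fun i => `|f i + g i|%:E).
Proof.
apply: (@summable_dominated _ (fun i => `|f i| + `|g i|)).
  by move=> i; rewrite normr_ge0 ler_normD.
under eq_esum do rewrite EFinD.
by rewrite esumD ?lte_add_pinfty ?wiener_fin// => i _; rewrite lee_fin.
Qed.
Definition wiener_add f g := Wiener (addP f g).

Let oppP f : summable setT (fun i => `|- f i|%:E).
Proof. by under eq_fun do rewrite normrN; exact: fcoefP. Qed.
Definition wiener_opp f := Wiener (oppP f).

Let addA : associative wiener_add.
Proof. by move=> f g h; apply: wienerP => i /=; rewrite addrA. Qed.
Let addC : commutative wiener_add.
Proof. by move=> f g; apply: wienerP => i /=; rewrite addrC. Qed.
Let add0 : left_id wiener0 wiener_add.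
Proof. by move=> f; apply: wienerP => i /=; rewrite add0r. Qed.
Let addN : left_inverse wiener0 wiener_opp wiener_add.
Proof. by move=> f; apply: wienerP => i /=; rewrite addNr. Qed.

HB.instance Definition _ := GRing.isZmodule.Build (wiener nu)
  addA addC add0 addN.

Let esum_scale_le (c : R) (u : int -> R) : 0 <= c -> (forall i, 0 <= u i) ->
  (\esum_(i in setT) (c * u i)%:E <= c%:E * \esum_(i in setT) (u i)%:E)%E.
Proof.
move=> c0 u0; apply: ge_ereal_sup => _ [X [finX _] <-].
have -> : (\sum_(i \in X) (c * u i)%:E = c%:E * \sum_(i \in X) (u i)%:E)%E.
  rewrite !fsbig_finite//= ge0_sume_distrr//.
  by move=> i _; rewrite lee_fin.
apply: lee_wpmul2l; rewrite ?lee_fin//.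
by apply: esum_ge; exists X.
Qed.

Lemma esum_scale (c : R) (u : int -> R) : 0 <= c -> (forall i, 0 <= u i) ->
  (\esum_(i in setT) (c * u i)%:E = c%:E * \esum_(i in setT) (u i)%:E)%E.
Proof.
rewrite le_eqVlt => /predU1P[<- u0|c0 u0].
  by rewrite mul0e esum1// => i _; rewrite mul0r.
apply/eqP; rewrite eq_le esum_scale_le ?(ltW c0)//=.
have cV0 : 0 <= c^-1 by rewrite invr_ge0 ltW.
rewrite muleC -lee_pdivlMr// muleC.
apply: le_trans (esum_scale_le cV0 _); last by move=> i; rewrite mulr_ge0// ltW.
by apply: le_esum => i _; rewrite mulrA mulVf ?mul1r// gt_eqF.
Qed.

Let scaleP (c : R) f : summable setT (fun i => `|c *: f i|%:E).
Proof.
under eq_fun do rewrite normrZ.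
rewrite summable_nonneg; last by move=> i; rewrite mulr_ge0.
rewrite esum_scale//; apply: lte_mul_pinfty; rewrite ?lee_fin//.
exact: wiener_fin.
Qed.
Definition wiener_scale c f := Wiener (scaleP c f).

Let scaleA a b f : wiener_scale a (wiener_scale b f) = wiener_scale (a * b) f.
Proof. by apply: wienerP => i /=; rewrite scalerA. Qed.
Let scale1 : left_id 1 wiener_scale.
Proof. by move=> f; apply: wienerP => i /=; rewrite scale1r. Qed.
Let scaleDr : right_distributive wiener_scale +%R.
Proof. by move=> a f g; apply: wienerP => i /=; rewrite scalerDr. Qed.
Let scaleDl f : {morph wiener_scale^~ f : a b / a + b}.
Proof. by move=> a b; apply: wienerP => i /=; rewrite scalerDl. Qed.

HB.instance Definition _ := GRing.Zmodule_isLmodule.Build R (wiener nu)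
  scaleA scale1 scaleDr scaleDl.

Definition wiener_norm f : R := fine (\esum_(i in setT) `|f i|%:E).

Lemma wiener_normE f : (wiener_norm f)%:E = (\esum_(i in setT) `|f i|%:E)%E.
Proof.
rewrite /wiener_norm fineK// ge0_fin_numE ?wiener_fin//.
by apply: esum_ge0 => i _; rewrite lee_fin.
Qed.

Let norm_triangle f g : wiener_norm (f + g) <= wiener_norm f + wiener_norm g.
Proof.
rewrite -lee_fin EFinD !wiener_normE -esumD//.
by apply: le_esum => i _; rewrite -EFinD lee_fin; exact: ler_normD.
Qed.

Let norm_scale (c : R) f : wiener_norm (c *: f) = `|c| * wiener_norm f.
Proof.
apply: EFin_inj; rewrite EFinM !wiener_normE -esum_scale//.
by apply: eq_esum => i _; rewrite -normrZ.
Qed.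

Let norm_eq0 f : wiener_norm f = 0 -> f = 0.
Proof.
move=> f0; apply: wienerP => i; apply/eqP; rewrite -normr_le0 -lee_fin.
rewrite -[X in (_ <= X%:E)%E]f0 wiener_normE.
apply: esum_ge; exists [set i]; first by split.
by rewrite fsbig_set1.
Qed.

HB.instance Definition _ := Lmodule_isNormed.Build R (wiener nu)
  norm_triangle norm_scale norm_eq0.

End WienerInstances.

Section Loops.
Context (R : realType) (n : nat) (nu : matrix_norm R n).
Implicit Types (f g : wiener nu) (u : int -> mat nu).

Definition zsum u : mat nu :=
  limn (fun m => \sum_(i < m.*2.+1) u (i%:Z - m%:Z)).

Lemma le_norm_zsum u : (`|zsum u|%:E <= \esum_(i in setT) `|u i|%:E)%E.
Proof.
rewrite /zsum; set s := (fun m => _).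
have s_le m : (`|s m|%:E <= \esum_(i in setT) `|u i|%:E)%E.
  apply: (@le_trans _ _ (\sum_(i < m.*2.+1) `|u (i%:Z - m%:Z)|%:E)%E).
    by rewrite sumEFin lee_fin; exact: ler_norm_sum.
  apply: esum_ge.
  exists [set (i%:Z - m%:Z)%R | i in `I_m.*2.+1].
    by split => //; exact: finite_image.
  rewrite fsbig_image; last by move=> i j _ _ /addIr[].
  by rewrite -(fsbig_ord _ _ (fun i => `|u (i%:Z - m%:Z)|%:E)).
have [cs|/dvgP ->] := pselect (cvgn s); last first.
  by rewrite normr0; apply: esum_ge0 => i _; rewrite lee_fin.
have [fin|] := ltP (\esum_(i in setT) `|u i|%:E)%E +oo%E; last first.
  by rewrite leye_eq => /eqP ->; rewrite leey.
rewrite -[leRHS]fineK; last first.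
  by rewrite ge0_fin_numE// esum_ge0// => i _; rewrite lee_fin.
rewrite lee_fin -(cvg_lim _ (cvg_norm cs))//.
apply: limr_le; first exact: is_cvg_norm.
near=> m.
rewrite -lee_fin fineK//.
by rewrite ge0_fin_numE// esum_ge0// => i _; rewrite lee_fin.
Unshelve. all: by end_near. Qed.

Definition convolution f g (k : int) : mat nu := zsum (fun i => f i * g (k - i)).

Lemma mat_normM (A B : mat nu) : `|A * B| <= `|A| * `|B|.
Proof. exact: mxn_mul. Qed.

Let convolutionP f g : summable setT (fun k => `|convolution f g k|%:E).
Proof.
rewrite summable_nonneg//.
apply: (@le_lt_trans _ _
  (\esum_(k in setT) \esum_(i in setT) (`|f i| * `|g (k - i)|)%:E)%E).
  apply: le_esum => k _; apply: le_trans (le_norm_zsum _) _.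
  by apply: le_esum => i _; rewrite lee_fin mat_normM.
rewrite esum_esum; last by move=> *; rewrite lee_fin mulr_ge0.
rewrite (@reindex_esum _ _ _ (setT `*`` (fun=> setT)) _
  (fun p : int * int => (p.2, p.1)));
  last first.
  split=> //; first by move=> [a b] [c d] _ _ [-> ->].
  by move=> [a b] _; exists (b, a).
rewrite -(@esum_esum _ _ _ setT (fun=> setT)
  (fun i k => (`|f i| * `|g (k - i)|)%:E)); last first.
  by move=> *; rewrite lee_fin mulr_ge0.
have -> : (\esum_(i in setT) \esum_(k in setT) (`|f i| * `|g (k - i)|)%:E
    = \esum_(i in setT) (wiener_norm g * `|f i|)%:E)%E.
  apply: eq_esum => i _; rewrite esum_scale// mulrC EFinM; congr (_ * _)%E.
  rewrite wiener_normE; apply/esym.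
  rewrite (@reindex_esum _ _ _ setT _ (fun k => k - i))//.
  split=> //; first by move=> a b _ _ /addIr.
  by move=> k _; exists (k + i) => //; rewrite addrK.
rewrite esum_scale//; last by rewrite -lee_fin wiener_normE esum_ge0.
apply: lte_mul_pinfty; rewrite ?wiener_fin//.
by rewrite wiener_normE esum_ge0// => i _; rewrite lee_fin.
Qed.

(* The pointwise product of loops, on Fourier coefficients. *)
Definition loop_mul f g : wiener nu := Wiener (convolutionP f g).

Let const_loopP (A : mat nu) :
  summable setT (fun i : int => `|if i == 0 then A else 0|%:E).
Proof.
rewrite summable_nonneg// (esumID [set 0%R])//.
rewrite setTI esum_set1// esum1 ?adde0 ?ltry// => i [_ /eqP/negPf ->].
by rewrite normr0.
Qed.
Definition const_loop (A : mat nu) : wiener nu := Wiener (const_loopP A).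

Definition loop_one : wiener nu := const_loop 1.

(* The inverse of an invertible loop; a default value otherwise. *)
Definition loop_inv f : wiener nu :=
  get [set g | loop_mul f g = loop_one /\ loop_mul g f = loop_one].

Definition loop_eval f (z : R[i]) : mat nu := zsum (fun i => cscale (z ^ i) (f i)).

End Loops.

Section LoopGroups.
Context (R : realType) (n : nat) (nu : matrix_norm R n).
Implicit Types (G : set (mat nu)) (H K : set (wiener nu)).

Definition circle : set R[i]^o := [set z : R[i]^o | `|z| = 1].
Definition open_disc : set R[i]^o := [set z : R[i]^o | `|z| < 1].
Definition closed_disc : set R[i]^o := [set z : R[i]^o | `|z| <= 1].

(* Entrywise complex differentiability: R[i]^o is normed over R[i]. *)
Definition holomorphic_on (D : set R[i]^o) (f : R[i]^o -> mat nu) :=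
  forall z, D z -> forall j k,
    derivable (fun w : R[i]^o => (f w : 'M[R[i]]_n) j k : R[i]^o) z 1.

Definition disc_extension G (u f : R[i]^o -> mat nu) :=
  [/\ holomorphic_on open_disc f, (forall z, open_disc z -> G (f z)),
      {within closed_disc, continuous f} &
      forall z, circle z -> f z = u z].

Definition LambdaG G : set (wiener nu) :=
  [set g | forall z, circle z -> G (loop_eval g z)].

(* LambdaM, LambdaM1: the exterior disc D_- is the unit disc in the coordinate
   1/z, infinity being its centre. *)
Definition LambdaP G : set (wiener nu) :=
  [set g | LambdaG G g /\ exists f, disc_extension G (loop_eval g) f].
Definition LambdaM G : set (wiener nu) :=
  [set g | LambdaG G g /\
     exists f, disc_extension G (fun z => loop_eval g z^-1) f].
Definition LambdaP1 G : set (wiener nu) :=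
  [set g | LambdaG G g /\
     exists f, disc_extension G (loop_eval g) f /\ f 0 = 1].
Definition LambdaM1 G : set (wiener nu) :=
  [set g | LambdaG G g /\
     exists f, disc_extension G (fun z => loop_eval g z^-1) f /\ f 0 = 1].

Definition identity_component (X : set (wiener nu)) : set (wiener nu) :=
  connected_component X (loop_one nu).

Definition loop_subgroup H :=
  [/\ H (loop_one nu), (forall g h, H g -> H h -> H (loop_mul g h)) &
      forall g, H g -> exists h,
        [/\ H h, loop_mul g h = loop_one nu & loop_mul h g = loop_one nu]].

(* LambdaG is itself a split submanifold of the Wiener algebra, so being a
   submanifold of one or of the other is the same for a subset of LambdaG. *)
Definition banach_lie_subgroup G H :=
  [/\ H `<=` LambdaG G, loop_subgroup H, closure H `&` LambdaG G `<=` H &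
      analytic_submanifold H].

Definition triple_mul (p : wiener nu * wiener nu * wiener nu) : wiener nu :=
  loop_mul (loop_mul p.1.1 p.1.2) p.2.

Definition triples (A B C : set (wiener nu)) :
  set (wiener nu * wiener nu * wiener nu)%type := (A `*` B) `*` C.

Definition open_dense_in (X A : set (wiener nu)) :=
  [/\ A `<=` X, (exists2 O, open O & A = X `&` O) & X `<=` closure A].

Definition birkhoff_cell (A B C : set (wiener nu)) : set (wiener nu) :=
  triple_mul @` triples A B C.

Definition birkhoff_decomposable K Kp K0 Km :=
  [/\ open_dense_in (identity_component K) (birkhoff_cell Kp K0 Km),
      open_dense_in (identity_component K) (birkhoff_cell Km K0 Kp),
      analytic_diffeo (triples Kp K0 Km) (birkhoff_cell Kp K0 Km) triple_mul &
      analytic_diffeo (triples Km K0 Kp) (birkhoff_cell Km K0 Kp) triple_mul].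

Definition plus_component G H := identity_component (H `&` LambdaP1 G).
Definition minus_component G H := identity_component (H `&` LambdaM1 G).
Definition const_component G H :=
  identity_component (H `&` LambdaP G `&` LambdaM G).

Definition birkhoff_subgroup G H :=
  [/\ banach_lie_subgroup G H,
      [/\ banach_lie_subgroup G (plus_component G H),
          banach_lie_subgroup G (const_component G H) &
          banach_lie_subgroup G (minus_component G H)] &
      birkhoff_decomposable H
        (plus_component G H) (const_component G H) (minus_component G H)].

Definition RB G H := birkhoff_cell
  (plus_component G H) (const_component G H) (minus_component G H).
Definition LB G H := birkhoff_cell
  (minus_component G H) (const_component G H) (plus_component G H).
Definition big_cell G H := LB G H `&` RB G H.

Section Maps.
Context (U : manifold R).
Implicit Types F : U -> wiener nu.

Definition maps_into K : set (U -> wiener nu) :=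
  [set F | smooth_map F /\ forall t, K (F t)].

(* F^-1 dF in the chart i, at the point with coordinates x, on the tangent
   vector with coordinates v. *)
Definition maurer_cartan F (i : mindex U) (x v : 'rV[R]_(mdim U)) : wiener nu :=
  loop_mul (loop_inv (F (mparam i x))) ('d (F \o mparam i) x v).

Definition connection_order (a b : \bar int) F :=
  forall i x v, (mchart i @` mdom i) x ->
  forall k : int, ~~ (a <= k%:E <= b)%E -> maurer_cartan F i x v k = 0.

Definition maps_order K a b : set (U -> wiener nu) :=
  maps_into K `&` connection_order a b.

Definition normalized_pair G H (a b : \bar int) (Gm Fp : U -> wiener nu) :=
  [/\ maps_order H a (-1)%E Gm, maps_order H 1%E b Fp,
      (forall t, (H `&` LambdaM1 G) (Gm t)) &
      (forall t, (H `&` LambdaP1 G) (Fp t))].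

Definition birkhoff_factors G H F (Gm Gp Fp Fm : U -> wiener nu) :=
  [/\ maps_into (H `&` LambdaM G) Fm, maps_into (H `&` LambdaP G) Gp,
      (forall t, F t = loop_mul (Fp t) (Fm t)) &
      (forall t, F t = loop_mul (Gm t) (Gp t))].

End Maps.

End LoopGroups.

(* Main.v *)
(* On the big cell the Birkhoff factors of [F] are analytic functions of [F], so
   smooth factors exist; the connection orders and uniqueness remain.  Both come
   from one fact: a loop extending holomorphically to the disc has no negative
   Fourier coefficients.  Indeed [F = F_+ F_-] gives
     [F_+^-1 dF_+ = F_- (F^-1 dF) F_-^-1 - dF_- F_-^-1],
   where the left side has only frequencies [>= 1] and the right side only
   frequencies [<= b]; the argument for [G_-] is the mirror image.  For
   uniqueness, a quotient of two positive factors equals a quotient of two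
   negative ones, hence is constant, and the normalization makes it [1].

   The Fourier fact is obtained without integration.  In the coordinates
   [z = e^(s + i t)] the means of a holomorphic function over the [2^N]-th roots
   of unity on two circles differ by a Riemann sum around a rectangle.  Dyadic
   refinement splits such sums exactly, so Goursat's bisection applies to the
   sums themselves and shows that they tend to [0]; this is the mean value
   property, and applied to [z^k g(z)] it computes the coefficient of index [-k].
   The laws of the loop product follow from those of matrices because
   evaluation on the circle is multiplicative (by density of trigonometric
   polynomials) and injective (by the same means over roots of unity). *)

Require Import Defs.
From HB Require Import structures.
From mathcomp Require Import all_boot all_order all_algebra.
From mathcomp Require Import perm complex ring lra zify.
From mathcomp Require Import all_classical all_reals all_analysis.

Set Implicit Arguments.
Unset Strict Implicit.
Unset Printing Implicit Defensive.

Import Order.TTheory GRing.Theory Num.Theory.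
Import numFieldNormedType.Exports.

Local Open Scope classical_set_scope.
Local Open Scope ring_scope.
Local Open Scope complex_scope.

(* [charge.v] rebinds this name. *)
Local Notation cscale := Defs.cscale.

(** * Continuous and smooth maps of normed spaces *)

Lemma morph_add0 (U V : zmodType) (L : U -> V) : {morph L : x y / x + y} -> L 0 = 0.
Proof. by move=> LD; apply: (addrI (L 0)); rewrite -LD !addr0. Qed.

Lemma morph_opp (U V : zmodType) (L : U -> V) :
  {morph L : x y / x + y} -> {morph L : x / - x}.
Proof.
by move=> LD x; apply: (addrI (L x)); rewrite -LD !subrr (morph_add0 LD).
Qed.

Lemma lipschitz_continuous (R : realType) (V W : normedModType R)
    (L : V -> W) (c : R) :
  {morph L : A B / A + B} -> (forall A, `|L A| <= c * `|A|) -> continuous L.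
Proof.
move=> LD Lc A.
apply/cvgrPdist_le => e e0.
have c1 : 0 < `|c| + 1 by rewrite ltr_wpDl.
near=> B; rewrite -(morph_opp LD) -LD; apply: le_trans (Lc _) _.
apply: (@le_trans _ _ ((`|c| + 1) * `|A - B|)).
  by rewrite ler_wpM2r// ler_wpDr// ler_norm.
rewrite mulrC -ler_pdivlMr//; near: B.
by apply: cvgr_dist_le => //; rewrite divr_gt0.
Unshelve. all: by end_near. Qed.

Section BoundedBilinear.
Context {R : realType} {U V W : normedModType R} (B : U -> V -> W).
Hypothesis BDl : forall u u' v, B (u + u') v = B u v + B u' v.
Hypothesis BDr : forall u v v', B u (v + v') = B u v + B u v'.
Hypothesis norm_B : forall u v, `|B u v| <= `|u| * `|v|.

Lemma bounded_bilinear_continuous : continuous (fun p : U * V => B p.1 p.2).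
Proof.
move=> [a b]; apply/cvgrPdist_le => e e0 /=.
have b1 : 0 < `|b| + 1 by rewrite ltr_wpDl.
have a1 : 0 < `|a| + 1 by rewrite ltr_wpDl.
have hu : \forall p \near (a, b), `|a - p.1| <= e / 2 / (`|b| + 1).
  by apply: (@cvgr_dist_le _ _ _ (nbhs (a, b)) _ fst a);
    [exact: cvg_fst|rewrite !divr_gt0].
have hv : \forall p \near (a, b), `|b - p.2| <= Num.min 1 (e / 2 / (`|a| + 1)).
  by apply: (@cvgr_dist_le _ _ _ (nbhs (a, b)) _ snd b);
    [exact: cvg_snd|rewrite lt_min ltr01 !divr_gt0].
apply: filterS2 hu hv => -[u v] /= hu; rewrite le_min => /andP[hv1 hv2].
have -> : B a b - B u v = B (a - u) v + B a (b - v).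
  have N1 x y : B (- x) y = - B x y.
    by apply: (@morph_opp _ _ (B^~ y)) => ? ?; exact: BDl.
  have N2 x y : B x (- y) = - B x y by apply: morph_opp => ? ?; exact: BDr.
  by rewrite BDl BDr N1 N2 [RHS]addrC addrA subrK.
rewrite [leRHS]splitr; apply: le_trans (ler_normD _ _) _; apply: lerD.
  apply: le_trans (norm_B _ _) _.
  have vb : `|v| <= `|b| + 1.
    rewrite -[v](subrK b); apply: le_trans (ler_normD _ _) _.
    by rewrite addrC lerD2l distrC.
  apply: (@le_trans _ _ (e / 2 / (`|b| + 1) * (`|b| + 1))); first exact: ler_pM.
  by rewrite mulfVK// gt_eqF.
apply: le_trans (norm_B _ _) _.
apply: (@le_trans _ _ ((`|a| + 1) * (e / 2 / (`|a| + 1)))).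
  by apply: ler_pM => //; rewrite lerDl.
by rewrite mulrCA divff ?mulr1// gt_eqF.
Qed.

End BoundedBilinear.

(** * Locality, chain rule and product rule for C^k maps *)

Section CkCalculus.
Context {R : realType}.
Implicit Types E F K W : normedModType R.

Definition tangent E F (f : E -> F) (p : E * E) : F := 'd f (p.1) (p.2).

Lemma CkS k E F (A : set E) (f : E -> F) : Ck k.+1 A f <->
  (forall x, A x -> differentiable f x) /\ Ck k (A `*` setT) (tangent f).
Proof. by []. Qed.

Lemma open_setXT E F (A : set E) : open A -> open (A `*` (setT : set F)).
Proof.
move=> oA; have -> : A `*` (setT : set F) = fst @^-1` A.
  by apply/seteqP; split=> [x []//|x Ax]; split.
by apply: open_comp => // x _; exact: cvg_fst.
Qed.

(** The differential is specified only through its first-order expansion, so that expansion is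
    carried from [f] to [g] and [diff_unique] identifies the two linear maps. *)
Lemma near_eq_diff E F (f g : E -> F) x :
  (\forall y \near x, f y = g y) -> differentiable f x ->
  differentiable g x /\ 'd g x = 'd f x :> (E -> F).
Proof.
move=> fg df; have fgx : f x = g x := nbhs_singleton fg.
have cdf : continuous ('d f x) by exact: diff_continuous.
have gE : g \o shift x = cst (g x) + 'd f x +o_ 0 id.
  have /eqaddoP fE := diff_locally df.
  apply/eqaddoP => e e0; near=> h.
  have -> : (g \o shift x - (cst (g x) + 'd f x)) h =
            (f \o shift x - (cst (f x) + 'd f x)) h.
    rewrite !fctE /= -fgx; congr (_ - _); apply/esym.
    near: h; move: fg; rewrite (near_shift 0 x).
    by apply: filterS => h /=; rewrite subr0.
  by near: h; exact: fE.
have dgE := diff_unique cdf gE.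
by split => //; apply/diff_locallyP; rewrite dgE.
Unshelve. all: by end_near. Qed.

(** The formulas for tangent maps below are available only on [A]; locality permits replacing a
    tangent map by its formula there. It also serves for maps that are given only by local
    extensions, as in [analytic_along]. *)
Lemma Ck_local k E F (A : set E) (f : E -> F) :
  (forall x, A x -> exists V (g : E -> F),
    [/\ open V, V x, Ck k V g & forall y, V y -> f y = g y]) -> Ck k A f.
Proof.
elim: k E F A f => [|k IH] E F A f loc.
  move=> x Ax; have [V [g [oV Vx cg fg]]] := loc x Ax.
  have nfg : {near x, g =1 f}.
    by near=> y; rewrite fg//; near: y; exact: open_nbhs_nbhs.
  rewrite /prop_for /continuous_at (fg _ Vx).
  exact: cvg_trans (near_eq_cvg nfg) (cg x Vx).
apply/CkS; split.
  move=> x Ax; have [V [g [oV Vx [dg _] fg]]] := loc x Ax.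
  apply: (proj1 (near_eq_diff _ (dg _ Vx))).
  by near=> y; rewrite fg//; near: y; exact: open_nbhs_nbhs.
apply: IH => -[x v] [/= Ax _].
have [V [g [oV Vx /CkS[dg cg] fg]]] := loc x Ax.
exists (V `*` setT), (tangent g); split => //.
- exact: open_setXT.
- move=> [y w] [/= Vy _]; rewrite /tangent (proj2 (near_eq_diff _ (dg _ Vy)))//=.
  by near=> z; rewrite fg//; near: z; exact: open_nbhs_nbhs.
Unshelve. all: by end_near. Qed.

Lemma Ck_eq k E F (A : set E) (f g : E -> F) : open A ->
  (forall x, A x -> f x = g x) -> Ck k A g -> Ck k A f.
Proof. by move=> oA fg gk; apply: Ck_local => x Ax; exists A, g. Qed.

Lemma CkW k E F (A : set E) (f : E -> F) : Ck k.+1 A f -> Ck k A f.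
Proof.
elim: k E F A f => [|k IH] E F A f.
  by move=> /CkS[df _] x Ax; apply: differentiable_continuous; exact: df.
by move=> /CkS[df /IH].
Qed.

Lemma Ck_sub k E F (A B : set E) (f : E -> F) : A `<=` B -> Ck k B f -> Ck k A f.
Proof.
elim: k E F A B f => [|k IH] E F A B f AB; first by move=> fB x /AB; exact: fB.
move=> /CkS[df fk]; apply/CkS; split; first by move=> x /AB; exact: df.
by apply: IH fk => -[x v] [/= /AB].
Qed.

Lemma Ck_lin k E F (A : set E) (f : {linear E -> F}) : open A ->
  continuous f -> Ck k A f.
Proof.
elim: k E F A f => [|k IH] E F A f oA cf; first by move=> x _; exact: cf.
apply/CkS; split; first by move=> x _; exact: linear_differentiable.
(* The tangent map of a linear [f] sends [(x, v)] to [f v]; it is again linear and continuous, so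
   the induction hypothesis applies to it. *)
have lin : linear (fun p : E * E => f p.2) by move=> c p q; rewrite /= linearP.
pose LM := GRing.isLinear.Build _ _ _ _ _ lin.
pose L : {linear (E * E)%type -> F} := HB.pack (fun p : E * E => f p.2) LM.
apply: (@Ck_eq _ _ _ _ _ L); first exact: open_setXT.
  by move=> [x v] _; rewrite /tangent/= diff_lin.
apply: IH; first exact: open_setXT.
by move=> p; apply: (@continuous_comp _ _ _ snd f); [exact: cvg_snd|exact: cf].
Qed.

Lemma Ck_pair k E F K (A : set E) (f : E -> F) (g : E -> K) : open A ->
  Ck k A f -> Ck k A g -> Ck k A (fun x => (f x, g x)).
Proof.
elim: k E F K A f g => [|k IH] E F K A f g oA.
  by move=> cf cg x Ax; apply: cvg_pair; [exact: cf|exact: cg].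
move=> /CkS[df cf] /CkS[dg cg]; apply/CkS; split.
  by move=> x Ax; apply: differentiable_pair; [exact: df|exact: dg].
apply: (@Ck_eq _ _ _ _ _ (fun p => (tangent f p, tangent g p))).
- exact: open_setXT.
- move=> [x v] [/= Ax _]; rewrite /tangent/= diff_pair//; first exact: df.
  exact: dg.
- by apply: IH => //; exact: open_setXT.
Qed.

(** By the chain rule the tangent map of [g \o f] is the composition of [tangent g] with
    [(f p.1, tangent f p)]. The induction therefore runs over all spaces at once, and [f] itself
    reappears with one order less. *)
Lemma Ck_comp k E F K (A : set E) (B : set F) (f : E -> F) (g : F -> K) :
  open A -> (forall x, A x -> B (f x)) ->
  Ck k A f -> Ck k B g -> Ck k A (g \o f).
Proof.
elim: k E F K A B f g => [|k IH] E F K A B f g oA AB.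
  by move=> cf cg x Ax; apply: continuous_comp; [exact: cf|apply: cg; exact: AB].
move=> ckf /CkS[dg cg]; have /CkS[df cf] := ckf; apply/CkS; split.
  by move=> x Ax; apply: differentiable_comp; [exact: df|apply: dg; exact: AB].
have oAT : open (A `*` (setT : set E)) by exact: open_setXT.
apply: (@Ck_eq _ _ _ _ _ (tangent g \o (fun p => (f p.1, tangent f p)))) => //.
  move=> [x v] [/= Ax _]; rewrite /tangent/= diff_comp//; first exact: df.
  by apply: dg; exact: AB.
apply: (IH) cg => //; first by move=> [x v] [/= /AB Bf _]; split.
apply: Ck_pair => //.
apply: (IH _ _ _ _ A fst f) (CkW ckf) => //; first by move=> ? [].
by apply: (@Ck_lin _ _ _ _ fst) => // p; exact: cvg_fst.
Qed.

Lemma CkD k E F (A : set E) (f g : E -> F) : open A ->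
  Ck k A f -> Ck k A g -> Ck k A (fun x => f x + g x).
Proof.
move=> oA fk gk.
have lin : linear (fun p : F * F => p.1 + p.2).
  by move=> c p q /=; rewrite scalerDr addrACA.
pose LM := GRing.isLinear.Build _ _ _ _ _ lin.
pose L : {linear (F * F)%type -> F} := HB.pack (fun p : F * F => p.1 + p.2) LM.
apply: (@Ck_comp _ _ _ _ A setT (fun x => (f x, g x)) L) => //.
  exact: Ck_pair.
apply: Ck_lin; first exact: openT.
by move=> p; apply: continuousD; [exact: cvg_fst|exact: cvg_snd].
Qed.

Lemma is_diff_bilin E F K W (B : {bilinear F -> K -> W}) (f : E -> F)
    (g : E -> K) x : continuous (fun p => B p.1 p.2) ->
  differentiable f x -> differentiable g x ->
  is_diff x (fun x => B (f x) (g x))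
    (fun v => B (f x) ('d g x v) + B ('d f x v) (g x)).
Proof.
move=> cB df dg; apply: DiffDef.
  apply: (@differentiable_comp _ _ _ _ (fun x => (f x, g x)) (fun p => B p.1 p.2)).
    exact: differentiable_pair.
  exact: differentiable_bilin.
rewrite (@diff_comp _ _ _ _ (fun x => (f x, g x)) (fun p => B p.1 p.2)).
- by rewrite diff_bilin//= diff_pair.
- exact: differentiable_pair.
- exact: differentiable_bilin.
Qed.

(** By the product rule the tangent map is a sum of two terms built from the same [B], each of them
    covered by the induction hypothesis. *)
Lemma Ck_bilin k E F K W (A : set E) (B : {bilinear F -> K -> W})
    (f : E -> F) (g : E -> K) : open A ->
  continuous (fun p => B p.1 p.2) ->
  Ck k A f -> Ck k A g -> Ck k A (fun x => B (f x) (g x)).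
Proof.
elim: k E F K W A B f g => [|k IH] E F K W A B f g oA cB.
  move=> cf cg x Ax.
  apply: (@continuous_comp _ _ _ (fun x => (f x, g x)) (fun p => B p.1 p.2)).
    by apply: cvg_pair; [exact: cf|exact: cg].
  exact: cB.
move=> ckf ckg; have /CkS[df cf] := ckf; have /CkS[dg cg] := ckg.
have oAT : open (A `*` (setT : set E)) by exact: open_setXT.
have Bdiff x : A x -> is_diff x (fun x => B (f x) (g x))
    (fun v => B (f x) ('d g x v) + B ('d f x v) (g x)).
  by move=> Ax; apply: is_diff_bilin; [exact: cB|exact: df|exact: dg].
have fst_comp (L : normedModType R) (h : E -> L) :
    Ck k A h -> Ck k (A `*` (setT : set E)) (h \o fst).
  move=> hk; apply: Ck_comp hk => //; first by move=> ? [].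
  by apply: (@Ck_lin _ _ _ _ fst) => // p; exact: cvg_fst.
apply/CkS; split; first by move=> x /Bdiff.
apply: (@Ck_eq _ _ _ _ _
  (fun p => B (f p.1) (tangent g p) + B (tangent f p) (g p.1))) => //.
  by move=> [x v] [/= /Bdiff dB _]; rewrite /tangent/= diff_val.
apply: CkD => //.
  by apply: (IH _ _ _ _ _ B (f \o fst)) => //; exact/fst_comp/CkW.
by apply: (IH _ _ _ _ _ B (tangent f) (g \o fst)) => //; exact/fst_comp/CkW.
Qed.

End CkCalculus.

(** * Complex matrices as a complete normed space *)

Section ComplexModulus.
Context {R : realType}.
Implicit Types z w : R[i].

(** The norm of [R[i]] takes its values in [R[i]]; this is the modulus as an element of [R],
    comparable with the norm of [mat nu]. *)
Definition cabs z : R := complex.Re `|z|.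

Lemma normcE_cabs z : `|z| = (cabs z)%:C.
Proof. by rewrite /cabs normc_def. Qed.

Lemma cabs_ge0 z : 0 <= cabs z.
Proof. by rewrite -ler0c -normcE_cabs. Qed.

Lemma cabsM z w : cabs (z * w) = cabs z * cabs w.
Proof. by apply: complexI; rewrite rmorphM/= -!normcE_cabs normrM. Qed.

Lemma cabsD z w : cabs (z + w) <= cabs z + cabs w.
Proof. by rewrite -lecR rmorphD/= -!normcE_cabs ler_normD. Qed.

Lemma cabsR (x : R) : cabs x%:C = `|x|.
Proof. by rewrite /cabs normc_def /= expr0n /= addr0 sqrtr_sqr. Qed.

Lemma cabs_i : cabs 'i = 1.
Proof. by rewrite /cabs normc_def /= expr0n /= expr1n add0r sqrtr1. Qed.

Lemma cabs0 : cabs 0 = 0.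
Proof. by rewrite /cabs normr0. Qed.

Lemma cabs_le_ReIm z : cabs z <= `|complex.Re z| + `|complex.Im z|.
Proof.
rewrite {1}[z]complexE (le_trans (cabsD _ _))//.
by rewrite cabsM cabs_i mul1r !cabsR.
Qed.

Lemma Re_le_cabs z : `|complex.Re z| <= cabs z.
Proof. by rewrite -lecR -normcE_cabs normc_ge_Re. Qed.

Lemma Im_le_cabs z : `|complex.Im z| <= cabs z.
Proof.
have := Re_le_cabs (z * 'i); rewrite ReiNIm normrN => /le_trans; apply.
by rewrite cabsM cabs_i mulr1.
Qed.

End ComplexModulus.

Section MatrixNorm.
Context {R : realType} {n : nat} {nu : matrix_norm R n}.
Implicit Types A B : mat nu.

Definition entry (A : mat nu) (j k : 'I_n) : R[i] := (A : 'M[R[i]]_n) j k.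

Lemma norm_cscale c A : `|cscale c A| = cabs c * `|A|.
Proof. exact: mxn_scale. Qed.

Lemma norm_scaleC c (A : 'M[R[i]]_n) : nu (c *: A) = cabs c * nu A.
Proof. exact: mxn_scale. Qed.

Lemma norm_mat_1 : `|1 : mat nu| = 1.
Proof. exact: mxn_1. Qed.

Lemma norm_entry_bound : exists2 c : R, 0 < c &
  forall A j k, cabs (entry A j k) <= c * `|A|.
Proof.
pose d j k : mat nu := delta_mx j k : 'M[R[i]]_n.
pose c := \sum_j \sum_k (`|d j j| * `|d j k|^-1 * `|d k k|).
have term_ge0 j k : 0 <= `|d j j| * `|d j k|^-1 * `|d k k|.
  by rewrite !mulr_ge0// invr_ge0.
have c0 : 0 <= c by apply: sumr_ge0 => j _; apply: sumr_ge0.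
(* The sum [c] dominates each of its terms, so one constant serves all entries; adding 1 keeps it
   positive even for [n = 0]. *)
exists (c + 1); first by rewrite ltr_wpDl.
move=> A j k.
have djk : 0 < `|d j k|.
  rewrite normr_gt0; apply/eqP => /matrixP /(_ j k) /eqP.
  by rewrite !mxE !eqxx/= oner_eq0.
(* [E_jj A E_kk = A_jk E_jk], and the norm is submultiplicative. *)
have Adel : d j j *m (A : 'M[R[i]]_n) *m d k k = entry A j k *: (d j k : 'M[R[i]]_n).
  apply/matrixP => r s; rewrite !mxE (bigD1 k)//= big1 ?addr0; last first.
    by move=> t tk; rewrite [d k k _ _]mxE (negPf tk) mulr0.
  rewrite !mxE eqxx (bigD1 j)//= big1 ?addr0; last first.
    by move=> t tj; rewrite [d j j _ _]mxE (negPf tj) andbF mul0r.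
  by rewrite !mxE eqxx andbT /entry; case: (r == j); case: (s == k);
    rewrite ?mulr1 ?mulr0 ?mul1r ?mul0r.
have : cabs (entry A j k) * `|d j k| <= `|d j j| * `|A| * `|d k k|.
  rewrite -[leLHS]norm_scaleC -Adel.
  apply: le_trans (mxn_mul _ _ _) _; apply: ler_wpM2r; first exact: normr_ge0.
  exact: mxn_mul.
rewrite -ler_pdivlMr// => /le_trans; apply.
have -> : `|d j j| * `|A| * `|d k k| / `|d j k| =
    (`|d j j| * `|d j k|^-1 * `|d k k|) * `|A| by ring.
apply: ler_wpM2r => //; apply: (@le_trans _ _ c); last by rewrite lerDl.
rewrite /c (bigD1 j)//= (bigD1 k)//= -addrA lerDl addr_ge0//.
  by apply: sumr_ge0.
by apply: sumr_ge0 => j' _; apply: sumr_ge0.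
Qed.

Lemma norm_mat_bound : exists2 c : R, 0 < c &
  forall A (e : R), 0 <= e -> (forall j k, cabs (entry A j k) <= e) ->
  `|A| <= c * e.
Proof.
pose d j k : mat nu := delta_mx j k : 'M[R[i]]_n.
pose c := \sum_j \sum_k `|d j k|.
have c0 : 0 <= c by apply: sumr_ge0 => j _; apply: sumr_ge0.
have Asum A : A = \sum_j \sum_k cscale (entry A j k) (d j k).
  exact: matrix_sum_delta.
exists (c + 1); first by rewrite ltr_wpDl.
move=> A e e0 Ae; rewrite [in leLHS](Asum A).
apply: (@le_trans _ _ (c * e)); last by rewrite ler_wpM2r// lerDl.
rewrite /c mulr_suml; apply: le_trans (ler_norm_sum _ _ _) _.
apply: ler_sum => j _; rewrite mulr_suml; apply: le_trans (ler_norm_sum _ _ _) _.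
by apply: ler_sum => k _; rewrite norm_cscale mulrC ler_wpM2l.
Qed.

End MatrixNorm.

Section Completeness.
Context {R : realType} {n : nat} {nu : matrix_norm R n}.

(** The two preceding bounds make [nu] equivalent to the maximum of the moduli of the entries, so
    completeness reduces to that of [R] for the real and imaginary parts of each entry. *)
Lemma mat_complete (F : set_system (mat nu)) :
  ProperFilter F -> cauchy F -> cvg F.
Proof.
move=> PF /cauchy_ballP Fc.
have [c c0 cP] := @norm_entry_bound R n nu.
have [d d0 dP] := @norm_mat_bound R n nu.
have coord (h : mat nu -> R) :
    (forall A B, `|h A - h B| <= c * `|A - B|) -> cvg (h @ F).
  move=> hL; apply: cauchy_cvg; apply/cauchy_ballP => e e0.
  have ec0 : 0 < e / c by rewrite divr_gt0.
  rewrite near_map2; have := Fc _ ec0; apply: filter_app.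
  near=> p => /=; rewrite -!ball_normE /= => lt.
  by apply: le_lt_trans (hL _ _) _; rewrite mulrC -ltr_pdivlMr.
have cRe j k : cvg ((fun A => complex.Re (entry A j k)) @ F).
  apply: coord => A B; apply: le_trans (cP (A - B) j k).
  apply: le_trans (Re_le_cabs _).
  by rewrite /entry !mxE; case: (A j k) => a b; case: (B j k).
have cIm j k : cvg ((fun A => complex.Im (entry A j k)) @ F).
  apply: coord => A B; apply: le_trans (cP (A - B) j k).
  apply: le_trans (Im_le_cabs _).
  by rewrite /entry !mxE; case: (A j k) => a b; case: (B j k).
pose L : mat nu := (\matrix_(j, k)
  (lim ((fun A => complex.Re (entry A j k)) @ F) +i*
   lim ((fun A => complex.Im (entry A j k)) @ F))) : 'M[R[i]]_n.
apply/cvg_ex; exists L; apply/cvgrPdist_le => e e0.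
have ed0 : 0 < e / d / 2 by rewrite !divr_gt0.
have nearF (h : mat nu -> 'I_n -> 'I_n -> R) :
    (forall j k, cvg ((fun A => h A j k) @ F)) ->
    \forall A \near F, forall jk : 'I_n * 'I_n,
      `|lim ((fun A => h A jk.1 jk.2) @ F) - h A jk.1 jk.2| <= e / d / 2.
  move=> ch; apply: filter_forall => -[j k] /=.
  exact: (@cvgr_dist_le _ _ _ _ _ _ _ (ch j k) _ ed0).
apply: filterS2 (nearF _ cRe) (nearF _ cIm) => A hRe hIm.
have -> : e = d * (e / d) by rewrite mulrCA divff ?mulr1// gt_eqF.
apply: dP => [|j k]; first by rewrite divr_ge0// ltW.
apply: le_trans (cabs_le_ReIm _) _; rewrite [leRHS]splitr; apply: lerD.
  have -> : complex.Re (entry (L - A) j k) =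
    lim ((fun A => complex.Re (entry A j k)) @ F) - complex.Re (entry A j k).
    by rewrite /entry !mxE; case: (A j k).
  exact: (hRe (j, k)).
have -> : complex.Im (entry (L - A) j k) =
  lim ((fun A => complex.Im (entry A j k)) @ F) - complex.Im (entry A j k).
  by rewrite /entry !mxE; case: (A j k).
exact: (hIm (j, k)).
Unshelve. all: by end_near. Qed.

HB.instance Definition _ := Uniform_isComplete.Build (mat nu) mat_complete.

End Completeness.

(** * The Wiener algebra *)

Section Zsum.
Context {R : realType} {n : nat} {nu : matrix_norm R n}.
Implicit Types u v : int -> mat nu.

(** The symmetric partial sum over the indices from [-m] to [m], whose limit defines [zsum]. *)
Definition zpart (V : normedModType R) (u : int -> V) m :=
  \sum_(i < m.*2.+1) u (i%:Z - m%:Z).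

Lemma zpartS (V : normedModType R) (u : int -> V) m :
  zpart u m.+1 = zpart u m + (u (- m.+1%:Z) + u m.+1%:Z).
Proof.
rewrite /zpart doubleS big_ord_recl big_ord_recr /= sub0r addrCA; congr (_ + _).
  by apply: eq_bigr => i _; congr u; rewrite /bump /= add1n -[i.+1]addn1 -[m.+1]addn1
    !PoszD opprD addrACA subrr addr0.
congr (_ + u _); rewrite /bump /= add1n -addnn -!addnS -[(_ + _)%N]/(m + m.+2)%N.
by rewrite -addSnnS PoszD addrK.
Qed.

Definition zsummable u := (\esum_(i in setT) `|u i|%:E < +oo)%E.

Lemma zpart_norm_le u m :
  ((zpart (fun i => `|u i|) m)%:E <= \esum_(i in setT) `|u i|%:E)%E.
Proof.
rewrite /zpart -sumEFin.
apply: esum_ge.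
exists [set (i%:Z - m%:Z)%R | i in `I_m.*2.+1].
  by split => //; exact: finite_image.
rewrite fsbig_image; last by move=> i j _ _ /addIr[].
by rewrite -(fsbig_ord _ _ (fun i => `|u (i%:Z - m%:Z)|%:E)).
Qed.

(** Grouping the indices [m + 1] and [-(m + 1)] turns the symmetric sums into an ordinary series,
    which converges absolutely. Without this fact [zsum] would be the limit of a possibly divergent
    sequence, hence a default value. *)
Lemma cvg_zpart u : zsummable u -> zpart u @ \oo --> zsum u.
Proof.
move=> su; suff h : cvgn (zpart u) by exact: h.
pose w m : mat nu := u (- m.+1%:Z) + u m.+1%:Z.
have zE m : zpart u m = zpart u 0 + series w m.
  elim: m => [|m IH]; first by rewrite seriesEnat/= big_geq// addr0.
  by rewrite zpartS IH seriesSr -addrA.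
have -> : zpart u = fun m => zpart u 0 + series w m by apply/funext.
apply: is_cvgD; first exact: is_cvg_cst.
apply: normed_cvg; apply: nondecreasing_is_cvgn.
  apply: nondecreasing_series => *; exact: normr_ge0.
exists (fine (\esum_(i in setT) `|u i|%:E)%E) => _ [m _ <-].
have le1 : series (fun m => `|w m|) m <= zpart (fun i => `|u i|) m.
  elim: m => [|m IH]; first by rewrite seriesEnat/= big_geq// sumr_ge0.
  rewrite zpartS seriesSr; apply: lerD; first exact: IH.
  exact: ler_normD.
apply: le_trans le1 _; rewrite -lee_fin fineK ?zpart_norm_le//.
by rewrite ge0_fin_numE//; apply: esum_ge0 => i _; rewrite lee_fin.
Qed.

Lemma zsum_unique u A : zpart u @ \oo --> A -> zsum u = A.
Proof. by move=> h; apply: cvg_lim => //; exact: norm_hausdorff. Qed.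

Lemma zsumD u v : zsummable u -> zsummable v ->
  zsum (fun i => u i + v i) = zsum u + zsum v.
Proof.
move=> su sv; apply: zsum_unique.
have -> : zpart (fun i => u i + v i) = fun m => zpart u m + zpart v m.
  by apply/funext => m; rewrite /zpart big_split.
by apply: cvgD; exact: cvg_zpart.
Qed.

Lemma zsum_map (L : mat nu -> mat nu) u : {morph L : A B / A + B} -> L 0 = 0 ->
  continuous L -> zsummable u -> zsum (fun i => L (u i)) = L (zsum u).
Proof.
move=> LD L0 cL su; apply: zsum_unique.
have -> : zpart (fun i => L (u i)) = fun m => L (zpart u m).
  by apply/funext => m; rewrite /zpart (big_morph L LD L0).
by apply: cvg_comp (cvg_zpart su) _; exact: cL.
Qed.

Lemma zsum_single (k : int) (A : mat nu) :
  zsum (fun i => if i == k then A else 0) = A.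
Proof.
apply: zsum_unique; apply: cvg_near_cst; exists `|k|%N => // m /= km.
have km0 : 0 <= k + m%:Z by lia.
have lt : (`|(k + m%:Z)%R|%N < m.*2.+1)%N by lia.
rewrite /zpart -big_mkcond (big_pred1 (Ordinal lt))// => i.
by apply/eqP/eqP => [ik|->/=]; [apply: val_inj => /=|]; lia.
Qed.

Lemma zsum0 : zsum (fun _ => 0) = 0 :> mat nu.
Proof.
apply: zsum_unique; have -> : zpart (fun _ => 0 : mat nu) = cst 0.
  by apply/funext => m; rewrite /zpart big1.
exact: cvg_cst.
Qed.

Lemma norm_zsum u M : (\esum_(i in setT) `|u i|%:E <= M%:E)%E -> `|zsum u| <= M.
Proof. by move=> uM; rewrite -lee_fin (le_trans (le_norm_zsum _)). Qed.

End Zsum.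

Section Wiener.
Context {R : realType} {n : nat} {nu : matrix_norm R n}.
Implicit Types f g : wiener nu.

Lemma norm_wienerE f : (`|f|%:E = \esum_(i in setT) `|f i|%:E)%E.
Proof. exact: wiener_normE. Qed.

Lemma wiener_norm_coef f k : `|f k| <= `|f|.
Proof.
rewrite -lee_fin norm_wienerE; apply: esum_ge; exists [set k]; first by split.
by rewrite fsbig_set1.
Qed.

Let mono_summable (k : int) (A : mat nu) :
  summable setT (fun i => `|if i == k then A else 0|%:E).
Proof.
rewrite summable_nonneg// (esumID [set k])//.
rewrite setTI esum_set1// esum1 ?adde0 ?ltry// => i [_ /eqP/negPf ->].
by rewrite normr0.
Qed.

Definition monomial k A : wiener nu := Wiener (mono_summable k A).

Lemma const_loopE A : const_loop A = monomial 0 A.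
Proof. by apply: wienerP. Qed.

Lemma coef_sum (I : Type) (s : seq I) (h : I -> wiener nu) k :
  (\sum_(i <- s) h i) k = \sum_(i <- s) h i k.
Proof. exact: (big_morph (fun f : wiener nu => f k)). Qed.

(** The norm is a supremum over finite sets of indices; a finite set that attains it up to [e]
    leaves a tail of norm at most [e]. *)
Lemma wiener_dense f (e : R) : 0 < e ->
  exists s : seq int, `|f - \sum_(i <- s) monomial i (f i)| <= e.
Proof.
move=> e0.
have fin : (\esum_(i in setT) `|f i|%:E)%E \is a fin_num.
  by rewrite -norm_wienerE.
have [_ [X [finX _] <-] ltX] := ub_ereal_sup_adherent e0 fin.
pose s : seq int := finmap.enum_fset (fset_set X); exists s.
have us : uniq s by exact: finmap.fset_uniq.
have sX k : (k \in X) = (k \in s) by rewrite -in_fset_set.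
have gE k : fcoef (f - \sum_(i <- s) monomial i (f i)) k = if k \in X then 0 else f k.
  rewrite -[LHS]/(f k - (\sum_(i <- s) monomial i (f i)) k) coef_sum/=.
  rewrite sX; case: ifPn => kX.
    rewrite (bigD1_seq k)//= eqxx big1 ?addr0 ?subrr// => i.
    by rewrite eq_sym => /negPf ->.
  rewrite big1_seq ?subr0// => i /andP[_ si].
  by case: eqP kX => // ->; rewrite si.
move: (f - _) gE => g gE.
rewrite -lee_fin norm_wienerE (esumID X)// setTI.
rewrite [X in (X + _)%E]esum1 ?add0e; last first.
  by move=> k /mem_set kX; rewrite /= gE kX normr0.
rewrite (eq_esum (b := fun k => `|f k|%:E)); last first.
  by move=> k [_ /= nX]; rewrite gE memNset.
move: ltX; rewrite -[ereal_sup _]/(\esum_(i in setT) `|f i|%:E)%E.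
rewrite (@esumID _ _ X setT (fun i => `|f i|%:E))//.
rewrite !setTI esum_fset// => ltX.
have finS : (\sum_(i \in X) `|f i|%:E)%R \is a fin_num.
  by rewrite fsbig_finite//= sumEFin.
by move: ltX; rewrite lteBlDr// lteD2lE// => /ltW.
Qed.

(** Since the bound [c] is uniform in [N], approximating [f] by a trigonometric polynomial costs an
    error independent of [N], and on the polynomial finitely many limits are added. *)
Lemma bounded_additive_cvg0 {V : normedModType R}
    (L : nat -> wiener nu -> V) (c : R) :
  (forall N, {morph L N : f g / f + g}) -> (forall N f, `|L N f| <= c * `|f|) ->
  (forall k A, L N (monomial k A) @[N --> \oo] --> 0) ->
  forall f, L N f @[N --> \oo] --> 0.
Proof.
move=> LD Lc Lm f; apply/cvgr0Pnorm_le => e e0.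
have c1 : 0 < `|c| + 1 by rewrite ltr_wpDl.
have e20 : 0 < e / 2 by rewrite divr_gt0.
have [s fs] := @wiener_dense f (e / 2 / (`|c| + 1)) (divr_gt0 e20 c1).
have Ls : L N (\sum_(i <- s) monomial i (f i)) @[N --> \oo] --> 0.
  elim: s {fs} => [|i s IH].
    by rewrite big_nil; under eq_fun do rewrite morph_add0//; exact: cvg_cst.
  rewrite big_cons; under eq_fun do rewrite LD.
  by have h := cvgD (Lm i (f i)) IH; rewrite addr0 in h; exact: h.
move: (\sum_(i <- s) _) Ls fs => S /cvgr0_norm_le /(_ _ e20) LS fS.
apply: filterS LS => N LS.
have -> : L N f = L N (f - S) + L N S by rewrite -LD subrK.
rewrite [leRHS]splitr; apply: le_trans (ler_normD _ _) _; apply: lerD => //.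
apply: le_trans (Lc _ _) _.
apply: (@le_trans _ _ ((`|c| + 1) * `|f - S|)).
  by rewrite ler_wpM2r// ler_wpDr// ler_norm.
by rewrite mulrC -ler_pdivlMr.
Qed.

Lemma bounded_additive_eq0 {V : normedModType R} (L : wiener nu -> V) (c : R) :
  {morph L : f g / f + g} -> (forall f, `|L f| <= c * `|f|) ->
  (forall k A, L (monomial k A) = 0) -> forall f, L f = 0.
Proof.
move=> LD Lc Lm f.
have : L f @[N --> \oo] --> 0.
  apply: (bounded_additive_cvg0 (fun _ => LD) (fun _ => Lc)) => k A.
  by rewrite Lm; exact: cvg_cst.
by move/cvg_lim => <-//; apply/esym; apply: cvg_lim => //; exact: cvg_cst.
Qed.

End Wiener.

(** * The convolution product of loops and their evaluation on the circle *)

Section LoopAlgebra.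
Context {R : realType} {n : nat} {nu : matrix_norm R n}.
Implicit Types f g : wiener nu.

Lemma cscaleA c d (A : mat nu) : cscale c (cscale d A) = cscale (c * d) A.
Proof. by rewrite /cscale scalerA. Qed.

Lemma cscale1 (A : mat nu) : cscale 1 A = A.
Proof. by rewrite /cscale scale1r. Qed.

Lemma cscaleD c (A B : mat nu) : cscale c (A + B) = cscale c A + cscale c B.
Proof. by rewrite /cscale scalerDr. Qed.

Lemma cscale0 c : cscale c 0 = 0 :> mat nu.
Proof. by rewrite /cscale scaler0. Qed.

Lemma cscaleMl c (A B : mat nu) : cscale c A * B = cscale c (A * B).
Proof. by rewrite /cscale -[LHS]/(_ *m _) -scalemxAl. Qed.

Lemma cscaleMr c (A B : mat nu) : A * cscale c B = cscale c (A * B).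
Proof. by rewrite /cscale -[LHS]/(_ *m _) -scalemxAr. Qed.

Lemma esum_reflect (u : int -> \bar R) (k : int) : (forall i, 0 <= u i)%E ->
  (\esum_(i in setT) u (k - i)%R = \esum_(i in setT) u i)%E.
Proof.
move=> u0; rewrite [RHS](@reindex_esum _ _ _ setT _ (fun i => k - i))//.
split=> //; first by move=> a b _ _ /addrI /oppr_inj.
by move=> j _; exists (k - j) => //; rewrite subKr.
Qed.

Lemma conv_summable f g k : zsummable (fun i => f i * g (k - i)).
Proof.
apply: (@le_lt_trans _ _ (\esum_(i in setT) (`|f| * `|g (k - i)|)%:E)%E).
  apply: le_esum => i _; rewrite lee_fin; apply: le_trans (mat_normM _ _) _.
  by apply: ler_wpM2r => //; exact: wiener_norm_coef.
rewrite esum_scale//; apply: lte_mul_pinfty; rewrite ?lee_fin//.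
rewrite (esum_reflect (u := fun i => `|g i|%:E))//.
exact: wiener_fin.
Qed.

(** Exchange the order of the double sum, which is legitimate for nonnegative terms, and translate
    the inner sum by [i]. *)
Lemma norm_loop_mul f g : `|loop_mul f g| <= `|f| * `|g|.
Proof.
rewrite -lee_fin norm_wienerE.
apply: (@le_trans _ _
  (\esum_(k in setT) \esum_(i in setT) (`|f i| * `|g (k - i)|)%:E)%E).
  apply: le_esum => k _; apply: le_trans (le_norm_zsum _) _.
  by apply: le_esum => i _; rewrite lee_fin mat_normM.
rewrite esum_esum; last by move=> *; rewrite lee_fin mulr_ge0.
rewrite (@reindex_esum _ _ _ (setT `*`` (fun=> setT)) _
  (fun p : int * int => (p.2, p.1))); last first.
  split=> //; first by move=> [a b] [c d] _ _ [-> ->].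
  by move=> [a b] _; exists (b, a).
rewrite -(@esum_esum _ _ _ setT (fun=> setT)
  (fun i k => (`|f i| * `|g (k - i)|)%:E)); last first.
  by move=> *; rewrite lee_fin mulr_ge0.
have -> : ((`|f| * `|g|)%:E = \esum_(i in setT) (`|g| * `|f i|)%:E)%E.
  by rewrite esum_scale// -norm_wienerE -EFinM mulrC.
apply: le_esum => i _; rewrite esum_scale// (mulrC `|g|) EFinM.
rewrite [in leRHS]norm_wienerE; apply: lee_wpmul2l; first by rewrite lee_fin.
rewrite (@reindex_esum _ _ _ setT setT (fun k => k + i) (fun k => `|g (k - i)|%:E))//.
  by apply: le_esum => k _; rewrite addrK.
by split=> //; [move=> a b _ _ /addIr|move=> k _; exists (k - i) => //; rewrite subrK].
Qed.

Lemma loop_mulDl f1 f2 g : loop_mul (f1 + f2) g = loop_mul f1 g + loop_mul f2 g.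
Proof.
apply: wienerP => k /=; rewrite -zsumD; [|exact: conv_summable..].
by congr zsum; apply/funext => i; rewrite mulrDl.
Qed.

Lemma loop_mulDr f g1 g2 : loop_mul f (g1 + g2) = loop_mul f g1 + loop_mul f g2.
Proof.
apply: wienerP => k /=; rewrite -zsumD; [|exact: conv_summable..].
by congr zsum; apply/funext => i; rewrite mulrDr.
Qed.

Lemma loop_mulZl (a : R) f g : loop_mul (a *: f) g = a *: loop_mul f g.
Proof.
apply: wienerP => k /=.
rewrite -[RHS](@zsum_map _ _ _ (fun A : mat nu => a *: A)).
- by congr zsum; apply/funext => i; exact: (cscaleMl a%:C).
- by move=> A B; rewrite scalerDr.
- by rewrite scaler0.
- exact: scaler_continuous.
- exact: conv_summable.
Qed.

Lemma loop_mulZr (a : R) f g : loop_mul f (a *: g) = a *: loop_mul f g.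
Proof.
apply: wienerP => k /=.
rewrite -[RHS](@zsum_map _ _ _ (fun A : mat nu => a *: A)).
- by congr zsum; apply/funext => i; exact: (cscaleMr a%:C).
- by move=> A B; rewrite scalerDr.
- by rewrite scaler0.
- exact: scaler_continuous.
- exact: conv_summable.
Qed.

Lemma loop_mul_monomial i j (A B : mat nu) :
  loop_mul (monomial i A) (monomial j B) = monomial (i + j) (A * B).
Proof.
apply: wienerP => k /=; rewrite /Defs.convolution.
have [->|kij] := eqVneq k (i + j).
  rewrite -[RHS](zsum_single i); congr zsum; apply/funext => l /=.
  by case: (eqVneq l i) => [->|_]; rewrite ?mul0r// addrC addKr eqxx.
rewrite -[RHS]zsum0; congr zsum; apply/funext => l /=.
case: (eqVneq l i) => [->|_]; rewrite ?mul0r//.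
by rewrite subr_eq addrC (negPf kij) mulr0.
Qed.

Lemma cabs_exprz z (k : int) : cabs z = 1 -> cabs (z ^ k) = 1 :> R.
Proof.
move=> z1; have nz : `|z| = 1 by rewrite normcE_cabs z1.
have h m : `|z ^+ m| = 1 by rewrite normrX nz expr1n.
by apply: complexI; rewrite -normcE_cabs; case: k => m;
  rewrite /exprz ?normfV h ?invr1.
Qed.

Lemma circle_cabs (z : R[i]) : circle z -> cabs z = 1.
Proof. by rewrite /circle /= /cabs => ->. Qed.

Lemma loop_eval_summable f z : circle z -> zsummable (fun i => cscale (z ^ i) (f i)).
Proof.
move=> /circle_cabs z1; rewrite /zsummable.
under eq_esum do rewrite norm_cscale cabs_exprz// mul1r.
exact: wiener_fin.
Qed.

Lemma norm_loop_eval f z : circle z -> `|loop_eval f z| <= `|f|.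
Proof.
move=> /circle_cabs z1; apply: norm_zsum; rewrite norm_wienerE.
by apply: le_esum => i _; rewrite norm_cscale cabs_exprz// mul1r.
Qed.

Lemma loop_evalD f g z : circle z ->
  loop_eval (f + g) z = loop_eval f z + loop_eval g z.
Proof.
move=> cz; rewrite -zsumD; [|exact: loop_eval_summable..].
by congr zsum; apply/funext => i; rewrite cscaleD.
Qed.

Lemma loop_eval_monomial k (A : mat nu) z :
  loop_eval (monomial k A) z = cscale (z ^ k) A.
Proof.
rewrite -[RHS](zsum_single k); congr zsum; apply/funext => l /=.
by case: (eqVneq l k) => [->//|_]; exact: cscale0.
Qed.

(** The defect [D] is additive and bounded in each argument, so by density it may be tested on
    monomials, first in [f] and then in [g]. *)
Lemma loop_eval_mul f g z : circle z ->
  loop_eval (loop_mul f g) z = loop_eval f z * loop_eval g z.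
Proof.
move=> cz; apply/eqP; rewrite -subr_eq0; apply/eqP.
pose D (h k : wiener nu) :=
  loop_eval (loop_mul h k) z - loop_eval h z * loop_eval k z.
have bound (h k : wiener nu) : `|D h k| <= 2 * `|h| * `|k|.
  rewrite -mulrA [leRHS]mulr_natl mulr2n; apply: le_trans (ler_normB _ _) _.
  apply: lerD.
    apply: le_trans (norm_loop_eval _ cz) _; exact: norm_loop_mul.
  apply: le_trans (mat_normM _ _) _.
  by apply: ler_pM => //; exact: norm_loop_eval.
have addl (k : wiener nu) : {morph D^~ k : h1 h2 / h1 + h2}.
  by move=> h1 h2; rewrite /D loop_mulDl !loop_evalD// mulrDl opprD addrACA.
have addr (h : wiener nu) : {morph D h : k1 k2 / k1 + k2}.
  by move=> k1 k2; rewrite /D loop_mulDr !loop_evalD// mulrDr opprD addrACA.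
apply: (@bounded_additive_eq0 _ _ _ _ _ (2 * `|g|) (addl g)) => {f}.
- by move=> f; rewrite mulrAC.
move=> i A.
apply: (@bounded_additive_eq0 _ _ _ _ _ (2 * `|monomial i A|) (addr _)) => {g}.
- by [].
move=> j B; rewrite /D loop_mul_monomial !loop_eval_monomial cscaleMl cscaleMr.
(* The exponents may be negative, so adding them requires [z] to be nonzero, which follows from its
   modulus being 1. *)
rewrite cscaleA -expfzDr ?subrr//; apply/eqP => z0.
by have := circle_cabs cz; rewrite z0 cabs0 => /eqP; rewrite eq_sym oner_eq0.
Qed.

End LoopAlgebra.

(** * Holomorphic functions on the disc *)

Section Goursat.
Context {R : realType} {V : normedModType R} (J : {linear V -> V}).
Hypothesis norm_J : forall v, `|J v| <= `|v|.
Implicit Types (g h : R -> V) (f : R -> R -> V).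

Definition rsum g (x a : R) (m : nat) : V :=
  (a / m%:R) *: \sum_(j < m) g (x + j%:R * (a / m%:R)).

(* With [J] as multiplication by [i], the left Riemann sum with [m] steps per
   side of the integral of [f dz] around [[x, x + a] * [y, y + b]]. *)
Definition contour f x y a b m : V :=
  rsum (f^~ y) x a m - rsum (f^~ (y + b)) x a m +
  J (rsum (f (x + a)) y b m - rsum (f x) y b m).

Lemma rsumB g h x a m :
  rsum (fun s => g s - h s) x a m = rsum g x a m - rsum h x a m.
Proof. by rewrite /rsum sumrB scalerBr. Qed.

Lemma rsum_cst (v : V) x a m : (0 < m)%N -> rsum (cst v) x a m = a *: v.
Proof.
move=> m0; rewrite /rsum sumr_const card_ord -[v *+ m]scaler_nat scalerA.
by rewrite mulfVK// pnatr_eq0 -lt0n.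
Qed.

(** Both halves use the mesh [a / (2m)] of the full interval, which makes the splitting an exact
    identity rather than an approximation. *)
Lemma rsum_double g x a m : (0 < m)%N ->
  rsum g x a (m + m) = rsum g x (a / 2) m + rsum g (x + a / 2) (a / 2) m.
Proof.
move=> m0; have m0R : m%:R != 0 :> R by rewrite pnatr_eq0 -lt0n.
have -> : rsum g x a (m + m) =
    (a / 2 / m%:R) *: \sum_(j < m + m) g (x + j%:R * (a / 2 / m%:R)).
  have -> : a / 2 / m%:R = a / (m + m)%:R by rewrite addnn -mul2n natrM invfM mulrA.
  by [].
rewrite big_split_ord/= scalerDr /rsum; congr (_ + _ *: _).
apply: eq_bigr => j _; congr (g _).
by rewrite natrD; field.
Qed.

(* The sums over inner edges cancel exactly, as they do for integrals. *)
Lemma contour_double f x y a b m : (0 < m)%N ->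
  contour f x y a b (m + m) =
  contour f x y (a / 2) (b / 2) m + contour f (x + a / 2) y (a / 2) (b / 2) m +
  contour f x (y + b / 2) (a / 2) (b / 2) m +
  contour f (x + a / 2) (y + b / 2) (a / 2) (b / 2) m.
Proof.
move=> m0; rewrite /contour !rsum_double// -!(addrA _ (_ / 2)) -!splitr.
rewrite !linearB/= !linearD/=.
set a1 := rsum (f^~ y) _ _ _; set a2 := rsum (f^~ y) _ _ _.
set a3 := rsum (f^~ (y + b)) _ _ _; set a4 := rsum (f^~ (y + b)) _ _ _.
set b1 := J (rsum (f (x + a)) _ _ _); set b2 := J (rsum (f (x + a)) _ _ _).
set b3 := J (rsum (f x) _ _ _); set b4 := J (rsum (f x) _ _ _).
set c1 := rsum _ _ _ _; set c2 := rsum _ _ _ _; set d1 := J _; set d2 := J _.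
set c3 := rsum (f^~ (y + b / 2)) _ _ _.
(* Of the sixteen edge terms the eight outer ones come first, in the order of the left side; the
   other eight are grouped into four pairs, the two opposite contributions of each inner edge. *)
rewrite [RHS](AC ((2*2)*(2*2)*(2*2)*(2*2))
  (((1*5)*(10*14))*((7*15)*(4*12))*(9*2)*(13*6)*(3*8)*(11*16))).
by rewrite /= !subrr !addr0.
Qed.

Lemma norm_rsum g x a m M : 0 <= a -> 0 <= M ->
  (forall t, x <= t <= x + a -> `|g t| <= M) -> `|rsum g x a m| <= a * M.
Proof.
move=> a0 M0 gM; rewrite /rsum; case: m => [|m].
  by rewrite big_ord0 scaler0 normr0 mulr_ge0.
rewrite normrZ ger0_norm ?divr_ge0//.
apply: (@le_trans _ _ (a / m.+1%:R * (m.+1%:R * M))); last by rewrite mulrA mulfVK.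
apply: ler_wpM2l; first by rewrite divr_ge0.
apply: le_trans (ler_norm_sum _ _ _) _.
apply: (@le_trans _ _ (\sum_(j < m.+1) M)); last first.
  by rewrite sumr_const card_ord mulr_natl.
apply: ler_sum => j _; apply: gM.
rewrite lerDl mulr_ge0 ?divr_ge0//= lerD2l mulrCA ler_piMr//.
by rewrite ler_pdivrMr// mul1r ler_nat ltnW.
Qed.

(** On opposite edges the function differs by a constant, [- (b *: J D)] for the horizontal and
    [a *: D] for the vertical pair. Riemann sums of constants are exact, and the two contributions
    cancel. *)
Lemma contour_affine (c D : V) x y a b m : (0 < m)%N ->
  contour (fun s t => c + (s *: D + t *: J D)) x y a b m = 0.
Proof.
move=> m0; have step g h v x' a' : (forall t, g t - h t = v) ->
    rsum g x' a' m - rsum h x' a' m = a' *: v.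
  by move=> /funext ghv; rewrite -rsumB ghv; exact: rsum_cst.
rewrite /contour (@step _ _ (- (b *: J D))); last first.
  by move=> t; rewrite opprD addrACA subrr add0r opprD addrACA subrr add0r
    scalerDl opprD addNKr.
rewrite (@step _ _ (a *: D)); last first.
  by move=> t; rewrite opprD addrACA subrr add0r opprD addrACA subrr addr0
    scalerDl addrAC subrr add0r.
have -> : J (b *: (a *: D)) = b *: (a *: J D).
  by rewrite linearZ/=; congr (_ *: _); rewrite linearZ.
by rewrite scalerN !scalerA mulrC addNr.
Qed.

Lemma contourB f k x y a b m :
  contour (fun s t => f s t - k s t) x y a b m =
  contour f x y a b m - contour k x y a b m.
Proof.
rewrite /contour !rsumB !linearB/= !opprD !opprK.
by rewrite [RHS]addrACA; congr (_ + _); exact: addrACA.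
Qed.

(** The usual length estimate, [2 * (a + b)] being the perimeter. *)
Lemma norm_contour f x y a b m M : 0 <= a -> 0 <= b -> 0 <= M ->
  (forall s t, x <= s <= x + a -> y <= t <= y + b -> `|f s t| <= M) ->
  `|contour f x y a b m| <= 2 * (a + b) * M.
Proof.
move=> a0 b0 M0 fM; rewrite /contour.
have h1 : `|rsum (f^~ y) x a m| <= a * M.
  by apply: norm_rsum => // t ?; apply: fM; rewrite // lexx lerDl.
have h2 : `|rsum (f^~ (y + b)) x a m| <= a * M.
  by apply: norm_rsum => // t ?; apply: fM; rewrite // lexx lerDl b0.
have h3 : `|rsum (f (x + a)) y b m| <= b * M.
  by apply: norm_rsum => // t ?; apply: fM; rewrite // lexx lerDl a0.
have h4 : `|rsum (f x) y b m| <= b * M.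
  by apply: norm_rsum => // t ?; apply: fM; rewrite // lexx lerDl.
apply: le_trans (ler_normD _ _) _.
apply: (@le_trans _ _ ((a * M + a * M) + (b * M + b * M))); last by lra.
apply: lerD; first by apply: le_trans (ler_normB _ _) _; exact: lerD.
apply: le_trans (norm_J _) _.
by apply: le_trans (ler_normB _ _) _; exact: lerD.
Qed.

(* The Cauchy-Riemann equation [d_y f = J (d_x f)]. *)
Definition cr_differentiable f x0 y0 := exists D : V, forall e : R, 0 < e ->
  exists2 d : R, 0 < d & forall x y, `|x - x0| < d -> `|y - y0| < d ->
  `|f x y - f x0 y0 - ((x - x0) *: D + (y - y0) *: J D)| <=
    e * (`|x - x0| + `|y - y0|).

Definition large f x y a b e :=
  forall N0 : nat, exists2 N, (N0 <= N)%N & e < `|contour f x y a b (2 ^ N)|.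

(** If all four quarters were eventually bounded by [e / 4], the exact splitting [contour_double]
    would eventually bound the whole by [e]. *)
Lemma large_quarter f x y a b e : large f x y a b e ->
  exists x' y', [/\ x' = x \/ x' = x + a / 2, y' = y \/ y' = y + b / 2 &
    large f x' y' (a / 2) (b / 2) (e / 4)].
Proof.
move=> fe; apply: contrapT => nex.
have small x' y' : x' = x \/ x' = x + a / 2 -> y' = y \/ y' = y + b / 2 ->
    exists N0, forall N, (N0 <= N)%N ->
      `|contour f x' y' (a / 2) (b / 2) (2 ^ N)| <= e / 4.
  move=> hx hy; apply: contrapT => nN; apply: nex; exists x', y'; split => // N0.
  apply: contrapT => nN2; apply: nN; exists N0 => N NN0.
  by rewrite leNgt; apply/negP => lt; apply: nN2; exists N.
have [N1 h1] := small x y (or_introl erefl) (or_introl erefl).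
have [N2 h2] := small (x + a / 2) y (or_intror erefl) (or_introl erefl).
have [N3 h3] := small x (y + b / 2) (or_introl erefl) (or_intror erefl).
have [N4 h4] := small (x + a / 2) (y + b / 2) (or_intror erefl) (or_intror erefl).
(* The sum exceeds all four thresholds, and the successor provides the one doubling that the
   splitting consumes. *)
have [N NN0] := fe (N1 + N2 + N3 + N4).+1.
case: N NN0 => // N; rewrite ltnS => NN0.
rewrite expnS mul2n -addnn contour_double ?expn_gt0//.
apply/negP; rewrite -leNgt.
apply: (@le_trans _ _ (e / 4 + e / 4 + e / 4 + e / 4)); last by lra.
apply: le_trans (ler_normD _ _) (lerD _ (h4 _ _)); last first.
  by apply: leq_trans NN0; rewrite leq_addl.
apply: le_trans (ler_normD _ _) (lerD _ (h3 _ _)); last first.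
  by apply: leq_trans NN0; rewrite (leq_trans _ (leq_addr _ _))// leq_addl.
apply: le_trans (ler_normD _ _) (lerD (h1 _ _) (h2 _ _)).
  by apply: leq_trans NN0; rewrite -!addnA leq_addr.
by apply: leq_trans NN0; rewrite -addnA (leq_trans _ (leq_addr _ _))// leq_addl.
Qed.

Lemma nested_point (x : nat -> R) a : 0 <= a ->
  (forall k, x k.+1 = x k \/ x k.+1 = x k + a / 2 ^+ k / 2) ->
  exists p, forall k, x k <= p <= x k + a / 2 ^+ k.
Proof.
move=> a0 xS.
have ak k : 0 <= a / 2 ^+ k by rewrite divr_ge0// exprn_ge0.
have akS k : a / 2 ^+ k.+1 = a / 2 ^+ k / 2 by rewrite exprSr invfM mulrA.
have mono : nondecreasing_seq x.
  apply/nondecreasing_seqP => k; have := ak k.+1.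
  by rewrite akS; case: (xS k) => ->; [rewrite lexx|rewrite lerDl].
have anti : {homo (fun k => x k + a / 2 ^+ k) : n m / (n <= m)%N >-> m <= n}.
  apply/nonincreasing_seqP => k; rewrite akS.
  by have := ak k; case: (xS k) => ->; lra.
have ub k l : x k <= x l + a / 2 ^+ l.
  have [kl|/ltnW lk] := leqP k l.
    by apply: le_trans (mono _ _ kl) _; rewrite lerDl.
  by apply: le_trans (anti _ _ lk); rewrite lerDl.
exists (sup (range x)) => k; apply/andP; split.
  apply: ub_le_sup; last by exists k.
  by exists (x 0 + a / 2 ^+ 0) => _ [l _ <-].
by apply: ge_sup; [exists (x k), k|move=> _ [l _ <-]].
Qed.

Lemma goursat f x y a b : 0 <= a -> 0 <= b ->
  (forall s t, x <= s <= x + a -> y <= t <= y + b -> cr_differentiable f s t) ->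
  contour f x y a b (2 ^ N) @[N --> \oo] --> 0.
Proof.
move=> a0 b0 df.
suff small e : 0 < e -> ~ large f x y a b e.
  apply/cvgr0Pnorm_le => e e0; apply: contrapT => nsmall.
  apply: (small e e0) => N0; apply: contrapT => nN; apply: nsmall.
  exists N0 => // N /= NN0; rewrite leNgt; apply/negP => lt.
  by apply: nN; exists N.
move=> e0 le.
(* Here [q] is the lower left corner of a quarter, of the rectangle of generation [k] at [p], on
   which the sums remain large. *)
pose ok k (p q : R * R) := [/\ q.1 = p.1 \/ q.1 = p.1 + a / 2 ^+ k / 2,
  q.2 = p.2 \/ q.2 = p.2 + b / 2 ^+ k / 2 &
  large f q.1 q.2 (a / 2 ^+ k / 2) (b / 2 ^+ k / 2) (e / 4 ^+ k / 4)].
pose p := fix p k := if k is k'.+1 then get (ok k' (p k')) else (x, y).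
have halfS (c d : R) k : c / d ^+ k.+1 = c / d ^+ k / d.
  by rewrite exprSr invfM mulrA.
have pS k : large f (p k).1 (p k).2 (a / 2 ^+ k) (b / 2 ^+ k) (e / 4 ^+ k) ->
    ok k (p k) (p k.+1).
  move=> /large_quarter[x' [y' h]].
  by apply: (@getPex _ (ok k (p k))); exists (x', y').
have pl k : large f (p k).1 (p k).2 (a / 2 ^+ k) (b / 2 ^+ k) (e / 4 ^+ k).
  elim: k => [|k /pS[_ _]]; first by rewrite !expr0 !divr1.
  by rewrite !halfS.
have [x0 x0P] := @nested_point (fun k => (p k).1) a a0
  (fun k => let: And3 h _ _ := pS k (pl k) in h).
have [y0 y0P] := @nested_point (fun k => (p k).2) b b0
  (fun k => let: And3 _ h _ := pS k (pl k) in h).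
have [D fD] : cr_differentiable f x0 y0.
  apply: df; first by have := x0P 0%N; rewrite /= expr0 divr1.
  by have := y0P 0%N; rewrite /= expr0 divr1.
(* The length estimate will produce the factor [2 * (a + b) ^+ 2 / c], which this choice keeps below
   1; the summand 1 makes [c] positive when [a = b = 0]. *)
pose c := 2 * (a + b) ^+ 2 + 1.
have c0 : 0 < c by rewrite /c ltr_wpDl// mulr_ge0// sqr_ge0.
have [d d0 {}fD] := fD (e / c) (divr_gt0 e0 c0).
have [k kd] : exists k, (a + b) / 2 ^+ k < d.
  have : (a + b) * (2^-1) ^+ k @[k --> \oo] --> (a + b) * 0.
    apply: cvgM; first exact: cvg_cst.
    by apply: cvg_expr; rewrite ger0_norm; lra.
  rewrite mulr0 => /cvgr_lt /(_ _ d0) [k _ /(_ k (leqnn k))/=].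
  by rewrite exprVn => ?; exists k.
have [N _] := pl k 0%N.
apply/negP; rewrite -leNgt.
set a' := a / 2 ^+ k; set b' := b / 2 ^+ k.
have a'0 : 0 <= a' by rewrite divr_ge0// exprn_ge0.
have b'0 : 0 <= b' by rewrite divr_ge0// exprn_ge0.
have abE : a' + b' = (a + b) / 2 ^+ k by rewrite /a' /b' mulrDl.
(* The affine approximation of [f] at the common point of the rectangles; its contour sums vanish,
   so only the error of approximation is left. *)
pose L s t := (f x0 y0 - (x0 *: D + y0 *: J D)) + (s *: D + t *: J D).
have -> : contour f (p k).1 (p k).2 a' b' (2 ^ N) =
          contour (fun s t => f s t - L s t) (p k).1 (p k).2 a' b' (2 ^ N).
  by rewrite contourB contour_affine ?expn_gt0// subr0.
apply: le_trans (@norm_contour _ _ _ _ _ _ (e / c * (a' + b')) _ _ _ _) _ => //.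
- by rewrite mulr_ge0 ?addr_ge0// divr_ge0// ltW.
- move=> s t /andP[s1 s2] /andP[t1 t2].
  have /andP[x1 x2] := x0P k; have /andP[y1 y2] := y0P k.
  rewrite -/a' -/b' in x2 y2.
  have sx : `|s - x0| <= a' by rewrite ler_norml; apply/andP; split; lra.
  have ty : `|t - y0| <= b' by rewrite ler_norml; apply/andP; split; lra.
  have -> : f s t - L s t = f s t - f x0 y0 - ((s - x0) *: D + (t - y0) *: J D).
    rewrite /L !scalerBl -[in RHS]addrA -opprD; congr (_ - _).
    rewrite -addrA; congr (_ + _).
    by rewrite addrC [RHS]addrACA opprD.
  apply: le_trans (fD _ _ _ _) _.
  + by apply: le_lt_trans sx _; apply: le_lt_trans kd; rewrite -abE lerDl.
  + by apply: le_lt_trans ty _; apply: le_lt_trans kd; rewrite -abE lerDr.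
  by apply: ler_wpM2l; [rewrite divr_ge0// ltW|exact: lerD].
(* The perimeter and the error each contribute a factor [2 ^- k]; their product is exactly the
   [4 ^- k] in the lower bound for the sums. *)
- have -> : 2 * (a' + b') * (e / c * (a' + b')) =
           (2 * (a + b) ^+ 2 / c) * (e / (2 ^+ k * 2 ^+ k)).
    rewrite abE; field.
    by rewrite expf_neq0//= gt_eqF.
  rewrite -exprMn -natrM ger_pMl; last by rewrite divr_gt0// exprn_gt0.
  by rewrite ler_pdivrMr// mul1r /c lerDl.
Qed.

End Goursat.

(** * Exponential coordinates and roots of unity *)

Section Polar.
Context {R : realType}.
Implicit Types s t : R.

(** The complex exponential [e^(s + i t)]. *)
Definition polar s t : R[i] := (expR s * cos t) +i* (expR s * sin t).

Lemma polarD s s' t t' : polar (s + s') (t + t') = polar s t * polar s' t'.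
Proof.
apply/eqP; rewrite eq_complex/= expRD cosD sinD; apply/andP; split; apply/eqP; ring.
Qed.

Lemma polar00 : polar 0 0 = 1.
Proof. by rewrite /polar expR0 cos0 sin0 mulr1 mulr0. Qed.

Lemma cabs_polar s t : cabs (polar s t) = expR s.
Proof.
rewrite /cabs normc_def /= !exprMn -mulrDr cos2Dsin2 mulr1.
by rewrite sqrtr_sqr ger0_norm ?expR_ge0.
Qed.

Lemma polar_periodic s t : polar s (t + 2 * pi) = polar s t.
Proof. by rewrite /polar mulr_natl mulr2n addrA !sinDpi !cosDpi !opprK. Qed.

Lemma derive_bound (f : R -> R) (x df : R) : is_derive x 1 f df ->
  forall e : R, 0 < e -> exists2 d : R, 0 < d &
    forall h, `|h| < d -> `|f (x + h) - f x - h * df| <= e * `|h|.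
Proof.
move=> fdf e e0.
have fx : derivable f x 1 by [].
have := derivable_nbhs fx.
rewrite derive_val => /eqaddoP /(_ e e0) /nbhs_normP[d /= d0 dP].
exists d => // h hd; have := dP h; rewrite /= sub0r normrN => /(_ hd).
by rewrite !fctE /= [h%:A]mulr1 (addrC h) opprD addrA.
Qed.

Lemma polar_linear_approx (e : R) : 0 < e -> exists2 d : R, 0 < d &
  forall s t, `|s| < d -> `|t| < d ->
    cabs (polar s t - 1 - (s +i* t)) <= e * (`|s| + `|t|).
Proof.
(* The errors below add up to [8 * e1 * |t| + e1 * |s|], whence [e / 8]; the bound by 1 keeps
   [|1 + u|] at most 3. *)
move=> e0; have [e1 [e10 e11 e1e]] : exists e1 : R, [/\ 0 < e1, e1 <= 1 & e1 <= e / 8].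
  exists (Num.min (e / 8) 1).
  by rewrite lt_min ltr01 andbT divr_gt0// ge_min lexx orbT ge_min lexx.
have [d1 d10 h1] := derive_bound (is_derive_expR 0) e10.
have [d2 d20 h2] := derive_bound (is_derive_cos 0) e10.
have [d3 d30 h3] := derive_bound (is_derive_sin 0) e10.
exists (Num.min (Num.min d1 d2) (Num.min d3 e1)).
  by rewrite 2!lt_min d10 d20 lt_min d30 e10.
move=> s t; rewrite !(lt_min (`|_|)) => /andP[/andP[s1 s2] /andP[s3 s4]].
move=> /andP[/andP[t1 t2] /andP[t3 t4]].
have := h1 s s1; rewrite add0r expR0 mulr1 => {}h1.
have := h2 t t2; rewrite add0r cos0 sin0 oppr0 mulr0 subr0 => {}h2.
have := h3 t t3; rewrite add0r sin0 cos0 mulr1 subr0 => {}h3.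
set u := expR s - 1 in h1.
have eu : expR s = 1 + u by rewrite /u addrC subrK.
have us : `|u| <= 2 * `|s|.
  rewrite -[u](subrK s); apply: le_trans (ler_normD _ _) _.
  have : e1 * `|s| <= 1 * `|s| by rewrite ler_wpM2r.
  by move: h1; lra.
have u1 : `|1 + u| <= 3.
  by apply: le_trans (ler_normD _ _) _; rewrite normr1; lra.
apply: le_trans (cabs_le_ReIm _) _ => /=; rewrite oppr0 addr0 eu.
have -> : (1 + u) * cos t - 1 - s = (1 + u) * (cos t - 1) + (u - s) by ring.
have -> : (1 + u) * sin t - t = (1 + u) * (sin t - t) + u * t by ring.
have b1 : `|(1 + u) * (cos t - 1) + (u - s)| <= 3 * (e1 * `|t|) + e1 * `|s|.
  apply: le_trans (ler_normD _ _) (lerD _ h1).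
  by rewrite normrM ler_pM.
have b2 : `|(1 + u) * (sin t - t) + u * t| <= 3 * (e1 * `|t|) + 2 * (e1 * `|t|).
  apply: le_trans (ler_normD _ _) _; apply: lerD.
    by rewrite normrM ler_pM.
  by rewrite normrM mulrA ler_wpM2r//; move: us s4; lra.
have c1 : e1 * `|t| <= e / 8 * `|t| by rewrite ler_wpM2r.
have c2 : e1 * `|s| <= e / 8 * `|s| by rewrite ler_wpM2r.
have c3 : 0 <= e * `|s| by rewrite mulr_ge0// ltW.
by lra.
Qed.

Lemma polarV t : polar 0 (- t) = (polar 0 t)^-1.
Proof.
have h : polar 0 t * polar 0 (- t) = 1 by rewrite -polarD addr0 subrr polar00.
by apply: (mulrI (x := polar 0 t)); rewrite ?h ?divrr//;
  apply/unitrP; exists (polar 0 (- t)); rewrite h mulrC h.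
Qed.

Lemma polarXn t m : polar 0 t ^+ m = polar 0 (m%:R * t).
Proof.
elim: m => [|m IH]; first by rewrite expr0 mul0r polar00.
by rewrite exprS IH -polarD addr0 -[m.+1]addn1 natrD mulrDl mul1r addrC.
Qed.

Lemma polarXz t (k : int) : polar 0 t ^ k = polar 0 (k%:~R * t).
Proof.
case: k => m; first by rewrite -exprnP polarXn.
by rewrite NegzE -exprnN polarXn -polarV mulrNz mulNr.
Qed.

(** Half of [|x|] lies strictly between 0 and [pi], where the sine is positive, and
    [cos x = 1 - 2 sin^2 (x / 2)]. *)
Lemma polar_neq1 x : 0 < `|x| -> `|x| < 2 * pi -> polar 0 x != 1.
Proof.
move=> x0 xpi; apply/eqP => /eqP.
rewrite eq_complex/= expR0 !mul1r => /andP[/eqP cosx _].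
have s0 : 0 < sin (`|x| / 2).
  by apply: sin_gt0_pi; apply/andP; split; lra.
have : cos `|x| = 1 by case: (ger0P x) => _; rewrite ?cosN.
have -> : `|x| = `|x| / 2 + `|x| / 2 by rewrite -splitr.
rewrite cosD -!expr2.
by have := exprn_gt0 2 s0; have := cos2Dsin2 (`|x| / 2); lra.
Qed.

(** A geometric sum with ratio [q] such that [q ^+ m = 1]; the bound on [k] excludes [q = 1]. *)
Lemma sum_polar (k : int) m : (`|k| < m)%N -> k != 0 ->
  \sum_(j < m) polar 0 (j%:R * (2 * pi / m%:R)) ^ k = 0.
Proof.
move=> km k0; have m0 : (0 < m)%N by apply: leq_ltn_trans km.
have m0R : (0 : R) < m%:R by rewrite ltr0n.
pose q := polar 0 (k%:~R * (2 * pi / m%:R)).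
have -> : \sum_(j < m) polar 0 (j%:R * (2 * pi / m%:R)) ^ k = \sum_(j < m) q ^+ j.
  by apply: eq_bigr => j _; rewrite polarXz polarXn mulrCA.
have q1 : q != 1.
  have pi0 := @pi_gt0 R.
  have pim : 0 < 2 * pi / m%:R :> R by rewrite divr_gt0 ?mulr_gt0.
  apply: polar_neq1; rewrite normrM (gtr0_norm pim).
    by rewrite mulr_gt0// normr_gt0 intr_eq0.
  rewrite mulrCA gtr_pMr ?mulr_gt0// ltr_pdivrMr// mul1r.
  by rewrite -intr_norm -[`|k|%R]abszE -pmulrn ltr_nat.
have qm : q ^+ m = 1.
  rewrite polarXn mulrCA [m%:R * _]mulrC mulfVK ?gt_eqF//.
  rewrite -polarXz.
  have -> : polar 0 (2 * pi) = 1 by rewrite -[2 * pi]add0r polar_periodic polar00.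
  by rewrite exp1rz.
apply/eqP; have := subrX1 q m; rewrite qm subrr => /esym/eqP.
by rewrite mulf_eq0 subr_eq0 (negPf q1).
Qed.

End Polar.

(** * Complex differentiability and the Cauchy-Riemann equation in exponential coordinates *)

Section DiscFunctions.
Context {R : realType} {n : nat} {nu : matrix_norm R n}.
Implicit Types (f g : R[i]^o -> mat nu).

(** Radii of balls in [R[i]^o] are elements of [R[i]]; a positive one is real, so neighbourhoods can
    be described with radii in [R]. *)
Lemma nbhs_cabs (z : R[i]^o) (P : set R[i]^o) :
  nbhs z P <-> exists2 d : R, 0 < d & forall w, cabs (w - z) < d -> P w.
Proof.
split=> [/(@nbhs_normP R[i] R[i]^o z P)[e /= e0 eP]|[d d0 dP]].
  have eE : e = (complex.Re e)%:C by rewrite [LHS]complexE (ger0_Im (ltW e0)) mulr0 addr0.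
  exists (complex.Re e); first by rewrite eE ltcR in e0.
  by move=> w wz; apply: eP => /=; rewrite distrC eE normcE_cabs ltcR.
apply/(@nbhs_normP R[i] R[i]^o z P); exists d%:C => /=; first by rewrite ltcR.
by move=> w /=; rewrite distrC normcE_cabs ltcR; exact: dP.
Qed.

Definition complex_differentiable f (z : R[i]) := exists D : mat nu,
  forall e : R, 0 < e -> exists2 d : R, 0 < d & forall w, cabs (w - z) < d ->
  `|f w - f z - cscale (w - z) D| <= e * cabs (w - z).

Lemma holomorphic_differentiable (A : set R[i]^o) f z :
  holomorphic_on A f -> A z -> complex_differentiable f z.
Proof.
move=> hf Az; have [c c0 cP] := @norm_mat_bound R n nu.
pose D : mat nu := \matrix_(j, k) 'D_1 (fun w : R[i]^o => entry (f w) j k : R[i]^o) z.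
exists D => e e0.
have ec : 0 < (e / c)%:C by rewrite ltcR divr_gt0.
have near_jk (jk : 'I_n * 'I_n) : \forall w \near z,
    cabs (entry (f w - f z - cscale (w - z) D) jk.1 jk.2) <= e / c * cabs (w - z).
  have /derivable_nbhs/eqaddoP/(_ _ ec)/nbhs_cabs[d d0 dP] := hf z Az jk.1 jk.2.
  apply/nbhs_cabs; exists d => // w wd; have := dP (w - z).
  rewrite subr0 => /(_ wd); rewrite !fctE /= !normcE_cabs -rmorphM lecR.
  apply: le_trans; rewrite le_eqVlt; apply/orP; left; apply/eqP; congr cabs.
  by rewrite /entry !mxE /= [(w - z)%:A]mulr1 subrK opprD addrA.
have /nbhs_cabs[d d0 dP] : \forall w \near z, forall jk : 'I_n * 'I_n,
    cabs (entry (f w - f z - cscale (w - z) D) jk.1 jk.2) <= e / c * cabs (w - z).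
  exact: (@filter_forall _ _ _ _ (@nbhs_filter R[i]^o z)).
exists d => // w wd; have -> : e = c * (e / c) by rewrite mulrCA divff ?mulr1// gt_eqF.
rewrite -mulrA; apply: cP => [|j k].
  by rewrite mulr_ge0 ?cabs_ge0// divr_ge0// ltW.
exact: (dP w wd (j, k)).
Qed.

Lemma norm_cscale_i (A : mat nu) : `|cscale 'i A| = `|A|.
Proof. by rewrite norm_cscale cabs_i mul1r. Qed.

Lemma cscale_i_linear : linear (cscale 'i : mat nu -> mat nu).
Proof.
move=> a A B; rewrite cscaleD; congr (_ + _).
by rewrite -[a *: A]/(cscale a%:C A) -[a *: _]/(cscale a%:C _) !cscaleA mulrC.
Qed.

HB.instance Definition _ := GRing.isLinear.Build R (mat nu) (mat nu) *:%R
  (cscale 'i : mat nu -> mat nu) cscale_i_linear.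

Definition mul_i : {linear mat nu -> mat nu} := cscale 'i : mat nu -> mat nu.

Lemma cscaleBl (c d : R[i]) (A : mat nu) : cscale (c - d) A = cscale c A - cscale d A.
Proof. by rewrite /cscale scalerBl. Qed.

Lemma cscaleDl (c d : R[i]) (A : mat nu) : cscale (c + d) A = cscale c A + cscale d A.
Proof. by rewrite /cscale scalerDl. Qed.

(** The expansion at the origin is transported by [polarD], so the derivative at a point is the
    value there. *)
Lemma polar_approx (s0 t0 : R) (e : R) : 0 < e -> exists2 d : R, 0 < d &
  forall s t, `|s - s0| < d -> `|t - t0| < d ->
    cabs (polar s t - polar s0 t0 - polar s0 t0 * ((s - s0) +i* (t - t0)))
      <= e * (`|s - s0| + `|t - t0|).
Proof.
move=> e0; have p0 : 0 < cabs (polar s0 t0) by rewrite cabs_polar expR_gt0.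
have [d d0 dP] := polar_linear_approx (divr_gt0 e0 p0).
exists d => // s t sd td; have := dP _ _ sd td.
have -> : polar s t = polar s0 t0 * polar (s - s0) (t - t0).
  by rewrite -polarD !(addrC _ (_ - _)) !subrK.
have -> : polar s0 t0 * polar (s - s0) (t - t0) - polar s0 t0 -
    polar s0 t0 * ((s - s0) +i* (t - t0)) =
    polar s0 t0 * (polar (s - s0) (t - t0) - 1 - ((s - s0) +i* (t - t0))) by ring.
by rewrite cabsM -ler_pdivlMl// mulrA [_^-1 * e]mulrC.
Qed.

Lemma cabs_complex_le (x y : R) : cabs (x +i* y) <= `|x| + `|y|.
Proof. exact: cabs_le_ReIm. Qed.

Lemma cr_differentiable_polar f s0 t0 :
  complex_differentiable f (polar s0 t0) ->
  cr_differentiable mul_i (fun s t => f (polar s t)) s0 t0.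
Proof.
move=> [D fD]; set p := polar s0 t0; exists (cscale p D) => e e0.
pose K := cabs p + 1.
have K0 : 0 < K by rewrite ltr_wpDl ?cabs_ge0.
(* The tolerance for [polar]: [e2 <= 1] bounds its increment by [K] times the displacement, and
   [e2 * |D| <= e / 2] leaves the other half of the error to [f]. *)
have [e2 [e20 e21 e2e]] : exists e2 : R,
    [/\ 0 < e2, e2 <= 1 & e2 * `|D| <= e / 2].
  have D1 : 0 < `|D| + 1 by rewrite ltr_wpDl.
  exists (Num.min 1 (e / 2 / (`|D| + 1))).
  rewrite lt_min ltr01 !divr_gt0// ge_min lexx; split => //.
  apply: (@le_trans _ _ (e / 2 / (`|D| + 1) * (`|D| + 1))).
    apply: ler_pM; rewrite ?lerDl// ?ge_min ?lexx ?orbT//.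
    by rewrite le_min ler01 !divr_ge0// ?ltW.
  by rewrite mulfVK// gt_eqF.
have e10 : 0 < e / (2 * K) by rewrite divr_gt0// mulr_gt0.
have [d1 d10 fP] := fD _ e10.
have [d2 d20 pP] := polar_approx s0 t0 e20.
have dK : 0 < d1 / (2 * K) by rewrite divr_gt0// mulr_gt0.
exists (Num.min d2 (d1 / (2 * K))); first by rewrite lt_min d20.
move=> s t; rewrite !(lt_min `|_|) => /andP[s2 s1] /andP[t2 t1].
have := pP s t s2 t2; rewrite -/p.
set z := (_ +i* _) => pz; set dl := `|s - s0| + `|t - t0|.
have dl0 : 0 <= dl by rewrite addr_ge0.
have Ez : cabs (polar s t - p) <= K * dl.
  rewrite -[polar s t - p](subrK (p * z)); apply: le_trans (cabsD _ _) _.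
  rewrite cabsM /K [leRHS]mulrDl mul1r addrC; apply: lerD.
    by apply: ler_wpM2l; [exact: cabs_ge0|exact: cabs_complex_le].
  by apply: le_trans pz _; rewrite ler_piMl.
have Ed : cabs (polar s t - p) < d1.
  apply: le_lt_trans Ez _; rewrite mulrC -ltr_pdivlMr//.
  have -> : d1 / K = d1 / (2 * K) + d1 / (2 * K).
    by field; rewrite gt_eqF.
  exact: ltrD.
have -> : f (polar s t) - f p -
      ((s - s0) *: cscale p D + (t - t0) *: mul_i (cscale p D)) =
    (f (polar s t) - f p - cscale (polar s t - p) D) + cscale (polar s t - p - p * z) D.
  rewrite [X in _ = _ + X]cscaleBl addrA subrK; congr (_ - _).
  rewrite -[_ *: cscale p D]/(cscale (s - s0)%:C _).
  rewrite -[(t - t0) *: _]/(cscale (t - t0)%:C (cscale 'i _)).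
  rewrite !cscaleA -cscaleDl; congr cscale.
  by rewrite /z [(s - s0) +i* _]complexE /=; ring.
apply: le_trans (ler_normD _ _) _.
apply: (@le_trans _ _ (e / (2 * K) * (K * dl) + (e2 * dl) * `|D|)).
  apply: lerD; last by rewrite norm_cscale ler_wpM2r.
  by apply: le_trans (fP _ Ed) _; rewrite ler_wpM2l// ltW.
have -> : e / (2 * K) * (K * dl) = e / 2 * dl.
  by field; rewrite gt_eqF.
apply: (@le_trans _ _ (e / 2 * dl + e / 2 * dl)); last by rewrite -mulrDl -splitr.
by rewrite lerD2l mulrAC ler_wpM2r.
Qed.

End DiscFunctions.

(** * The mean value property on the closed disc *)

Section MeanValue.
Context {R : realType} {n : nat} {nu : matrix_norm R n}.
Implicit Types (f g : R[i]^o -> mat nu).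

Definition disc_function f :=
  holomorphic_on (@open_disc R) f /\ {within @closed_disc R, continuous f}.

Lemma closed_discE (z : R[i]^o) : closed_disc z <-> cabs z <= 1.
Proof. by rewrite /closed_disc/= normcE_cabs -(rmorph1 (real_complex R)) lecR. Qed.

Lemma open_discE (z : R[i]^o) : open_disc z <-> cabs z < 1.
Proof. by rewrite /open_disc/= normcE_cabs -(rmorph1 (real_complex R)) ltcR. Qed.

Lemma circleE (z : R[i]^o) : circle z <-> cabs z = 1.
Proof.
rewrite /circle/= normcE_cabs; split => [|->//].
by rewrite -(rmorph1 (real_complex R)) => /complexI.
Qed.

Lemma disc_continuous f z (e : R) : disc_function f -> closed_disc z -> 0 < e ->
  exists2 d : R, 0 < d & forall w, closed_disc w -> cabs (w - z) < d ->
  `|f w - f z| <= e.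
Proof.
move=> [_ /subspace_continuousP cf] cz e0.
have /cvgrPdist_le /(_ e e0) := cf z cz.
rewrite near_withinE => /nbhs_cabs[d d0 dP]; exists d => // w cw wz.
by rewrite distrC; exact: dP.
Qed.

Lemma polar_continuous (s0 t0 e : R) : 0 < e -> exists2 d : R, 0 < d &
  forall s t, `|s - s0| < d -> `|t - t0| < d ->
    cabs (polar s t - polar s0 t0) < e.
Proof.
move=> e0; have [d d0 dP] := polar_approx s0 t0 (@ltr01 R).
pose K := cabs (polar s0 t0) + 1.
have K0 : 0 < K by rewrite ltr_wpDl ?cabs_ge0.
have eK : 0 < e / K / 2 by rewrite !divr_gt0.
exists (Num.min d (e / K / 2)); first by rewrite lt_min d0.
move=> s t; rewrite !(lt_min `|_|) => /andP[s1 s2] /andP[t1 t2].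
have := dP s t s1 t1; set z := (_ +i* _) => pz.
rewrite -[polar s t - _](subrK (polar s0 t0 * z)).
apply: le_lt_trans (cabsD _ _) _.
apply: (@le_lt_trans _ _ (K * (`|s - s0| + `|t - t0|))).
  rewrite cabsM /K mulrDl addrC; apply: lerD => //.
  by apply: ler_wpM2l; [exact: cabs_ge0|exact: cabs_complex_le].
by rewrite mulrC -ltr_pdivlMr// [ltRHS]splitr ltrD.
Qed.

(** Holomorphy is given only inside the disc, so the boundary circle has to be approached from
    within. Compactness of the interval of angles makes the approach uniform. *)
Lemma disc_radial_limit f (e : R) : disc_function f -> 0 < e ->
  exists2 s : R, s < 0 & forall t, 0 <= t <= 2 * pi ->
  `|f (polar s t) - f (polar 0 t)| <= e.
Proof.
move=> df e0; have e20 : 0 < e / 2 by rewrite divr_gt0.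
have /compact_near_coveringP K := @segment_compact R 0 (2 * pi).
have cpolar s t : s <= 0 -> closed_disc (polar s t : R[i]^o).
  by move=> s0; apply/closed_discE; rewrite cabs_polar -expR0 ler_expR.
have [] := K R (0^'-) (fun s t => `|f (polar s t) - f (polar 0 t)| <= e).
  move=> t0 _.
  have [d d0 dP] := disc_continuous df (cpolar 0 t0 (lexx _)) e20.
  have [r r0 rP] := polar_continuous 0 t0 d0.
  exists ([set t | `|t - t0| < r], [set s | - r < s /\ s < 0]).
    split => /=.
      apply: filterS (nbhsx_ballx t0 _ r0) => t.
      by rewrite -ball_normE /= distrC.
    have r0' : - r < 0 by rewrite oppr_lt0.
    by apply: filterS2 (nbhs_left_gt r0') (nbhs_left_lt 0) => s ? ?.
  move=> [t s] /= [tr [s1 s2]].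
  rewrite -[X in `|X|](subrKA (f (polar 0 t0))).
  rewrite [leRHS]splitr (le_trans (ler_normD _ _))// lerD//.
    apply: dP; first by apply: cpolar; exact: ltW.
    by apply: rP => //; rewrite subr0 ler0_norm ?ltW// ltrNl.
  rewrite distrC; apply: dP; first exact: cpolar.
  by apply: rP => //; rewrite subrr normr0.
move=> d /= d0 dP.
exists (- (d / 2)); first by rewrite oppr_lt0 divr_gt0.
move=> t tpi; apply: (dP (- (d / 2))).
- by rewrite /ball/= sub0r opprK gtr0_norm ?divr_gt0// ltr_pdivrMr// ltr_pMr// ltr1n.
- by rewrite oppr_lt0 divr_gt0.
- by rewrite /= in_itv.
Qed.

(* In the coordinates [z = e^(s + i t)] the difference of the means over two
   circles is a contour sum: the two radial sides cancel by periodicity. *)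
Theorem disc_mean_value f : disc_function f ->
  rsum (fun t => f (polar 0 t)) 0 (2 * pi) (2 ^ N) @[N --> \oo] --> (2 * pi) *: f 0.
Proof.
move=> df; have pi0 : 0 < 2 * pi :> R by rewrite mulr_gt0// pi_gt0.
apply/cvgrPdist_le => e e0.
(* One third of the error each for passing from the unit circle to radius [expR s2], from there to
   radius [expR s1] by Goursat, and from the small circle to the centre. *)
have e30 : 0 < e / 3 by rewrite divr_gt0.
have epi : 0 < e / 3 / (2 * pi) by rewrite divr_gt0.
have [s2 s20 s2P] := disc_radial_limit df epi.
have c0 : closed_disc (0 : R[i]^o) by apply/closed_discE; rewrite cabs0.
have [d d0 dP] := disc_continuous df c0 epi.
have [s1 [s12 s1P]] : exists s1 : R, s1 < s2 /\ expR s1 < d.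
  exists (Num.min (s2 - 1) (ln (d / 2))); split.
    by rewrite gt_min ltrBlDr ltrDl ltr01.
  apply: (@le_lt_trans _ _ (d / 2)); last by rewrite ltr_pdivrMr// ltr_pMr// ltr1n.
  rewrite -[leRHS]lnK ?posrE ?divr_gt0// ler_expR.
  by rewrite ge_min lexx orbT.
pose H s t := f (polar s t).
have dH s t : s < 0 -> cr_differentiable (@mul_i R n nu) H s t.
  move=> s0; apply: cr_differentiable_polar.
  apply: holomorphic_differentiable df.1 _.
  by apply/open_discE; rewrite cabs_polar -expR0 ltr_expR.
have normi v : `|@mul_i R n nu v| <= `|v| by rewrite norm_cscale_i.
have a0 : 0 <= s2 - s1 by rewrite subr_ge0 ltW.
have := @goursat R _ (@mul_i R n nu) normi H s1 0 (s2 - s1) (2 * pi) a0 (ltW pi0).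
have contourE N : contour (@mul_i R n nu) H s1 0 (s2 - s1) (2 * pi) (2 ^ N) =
    mul_i (rsum (H s2) 0 (2 * pi) (2 ^ N) - rsum (H s1) 0 (2 * pi) (2 ^ N)).
  rewrite /contour add0r subrKC.
  have -> : rsum (H^~ (2 * pi)) s1 (s2 - s1) (2 ^ N) = rsum (H^~ 0) s1 (s2 - s1) (2 ^ N).
    congr rsum; apply/funext => s; rewrite /H.
    by rewrite -[2 * pi]add0r polar_periodic.
  by rewrite subrr add0r.
have -> : (fun N => contour (@mul_i R n nu) H s1 0 (s2 - s1) (2 * pi) (2 ^ N)) =
  (fun N => mul_i (rsum (H s2) 0 (2 * pi) (2 ^ N) - rsum (H s1) 0 (2 * pi) (2 ^ N))).
  by apply/funext => N; exact: contourE.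
move=> /(_ _)/cvgr0_norm_le H0.
have {}H0 := H0 _ _ e30.
apply: filterS (H0 _) => [N hN|s t /andP[_ st] _]; last first.
  by apply: dH; apply: le_lt_trans st _; rewrite subrKC.
rewrite norm_cscale_i in hN.
have m0 : (0 < 2 ^ N)%N by rewrite expn_gt0.
have h1 : `|rsum (H s1) 0 (2 * pi) (2 ^ N) - (2 * pi) *: f 0| <= e / 3.
  rewrite -(@rsum_cst R _ (f 0) 0 (2 * pi) _ m0) -rsumB.
  have -> : e / 3 = 2 * pi * (e / 3 / (2 * pi)) by rewrite mulrCA divff ?mulr1// gt_eqF.
  apply: norm_rsum; [exact: ltW|exact: ltW|move=> t _].
  apply: dP; last by rewrite subr0 cabs_polar.
  apply/closed_discE; rewrite cabs_polar -expR0 ler_expR ltW//.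
  exact: lt_trans s20.
have h2 : `|rsum (H 0) 0 (2 * pi) (2 ^ N) - rsum (H s2) 0 (2 * pi) (2 ^ N)| <= e / 3.
  rewrite distrC -rsumB.
  have -> : e / 3 = 2 * pi * (e / 3 / (2 * pi)) by rewrite mulrCA divff ?mulr1// gt_eqF.
  apply: norm_rsum; [exact: ltW|exact: ltW|move=> t].
  by rewrite add0r; exact: s2P.
rewrite distrC -/(H 0).
set a := rsum (H 0) _ _ _ in h2 *; set b := rsum (H s2) _ _ _ in h2 hN.
set c := rsum (H s1) _ _ _ in h1 hN.
rewrite -(subrKA b) -[b - _](subrKA c).
apply: le_trans (ler_normD _ _) _; apply: le_trans (lerD (lexx _) (ler_normD _ _)) _.
by lra.
Qed.

End MeanValue.

Section DiscAlgebra.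
Context {R : realType} {n : nat} {nu : matrix_norm R n}.
Implicit Types (f g : R[i]^o -> mat nu).

Lemma cvg_matM (T : Type) (F : set_system T) {FF : Filter F}
    (f g : T -> mat nu) (a b : mat nu) :
  f @ F --> a -> g @ F --> b -> (fun t => f t * g t) @ F --> a * b.
Proof.
move=> fa gb.
have c : continuous (fun p : mat nu * mat nu => p.1 * p.2).
  apply: bounded_bilinear_continuous.
  - by move=> *; rewrite mulrDl.
  - by move=> *; rewrite mulrDr.
  - exact: mat_normM.
exact: (@cvg_comp _ _ _ (fun t => (f t, g t)) (fun p => p.1 * p.2) _ _ _
  (cvg_pair fa gb) (c (a, b))).
Qed.

Lemma disc_functionM f g :
  disc_function f -> disc_function g -> disc_function (fun z => f z * g z).
Proof.
move=> [hf /subspace_continuousP cf] [hg /subspace_continuousP cg]; split.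
  move=> z Dz j k.
  have -> : (fun w : R[i]^o => ((f w * g w : mat nu) : 'M[R[i]]_n) j k : R[i]^o) =
     \sum_(l < n) ((fun w => (f w : 'M[R[i]]_n) j l : R[i]^o) *
                  (fun w => (g w : 'M[R[i]]_n) l k : R[i]^o)).
    by apply/funext => w; rewrite fct_sumE mxE.
  apply: derivable_sum => l; apply: derivableM; [exact: hf|exact: hg].
apply/subspace_continuousP => z Dz.
by apply: cvg_matM; [exact: cf|exact: cg].
Qed.

Lemma disc_function_scalar (c : R[i]^o -> R[i]^o) :
  (forall z, derivable c z 1) -> disc_function (fun z => cscale (c z) (1 : mat nu)).
Proof.
move=> dc; split.
  move=> z _ j k.
  have -> : (fun w : R[i]^o => (cscale (c w) (1 : mat nu) : 'M[R[i]]_n) j k : R[i]^o) =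
     c * cst ((1 : 'M[R[i]]_n) j k).
    by apply/funext => w; rewrite mxE.
  by apply: derivableM => //; exact: derivable_cst.
apply/subspace_continuousP => z _; apply: cvg_within_filter.
have Fz : Filter (nbhs z) := nbhs_filter z.
apply/cvgrPdist_le => e e0.
have cc : {for z, continuous c}.
  by apply: differentiable_continuous; apply/derivable1_diffP.
have e0C : 0 < e%:C by rewrite ltcR.
have /nbhs_cabs[d d0 dP] : \forall w \near z, `|c z - c w| <= e%:C.
  by apply: (iffLR (@cvgrPdist_le _ _ _ _ Fz _ _) cc).
apply/nbhs_cabs; exists d => // w /dP; rewrite normcE_cabs lecR => cw.
by rewrite -cscaleBl norm_cscale norm_mat_1 mulr1.
Qed.

Lemma disc_function_exprn k :
  disc_function (fun z : R[i]^o => cscale (z ^+ k) (1 : mat nu)).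
Proof.
apply: disc_function_scalar => z; exact: exprn_derivable.
Qed.

Lemma disc_functionX f k :
  disc_function f -> disc_function (fun z => cscale (z ^+ k) (f z)).
Proof.
move=> df; have := disc_functionM (disc_function_exprn k) df.
by congr disc_function; apply/funext => z; rewrite cscaleMl mul1r.
Qed.

End DiscAlgebra.

(** * Fourier coefficients of loops *)

Section Fourier.
Context {R : realType} {n : nat} {nu : matrix_norm R n}.
Implicit Types f g : wiener nu.

Lemma circle_polar (t : R) : circle (polar 0 t : R[i]^o).
Proof. by apply/circleE; rewrite cabs_polar expR0. Qed.

(** The errors [L N] of the means are additive and uniformly bounded, so by density only monomials
    matter. *)
Lemma fourier_mean f (k : nat) :
  rsum (fun t => cscale (polar 0 t ^+ k) (loop_eval f (polar 0 t))) 0 (2 * pi) (2 ^ N)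
    @[N --> \oo] --> (2 * pi) *: f (- k%:Z).
Proof.
have pi0 : 0 < 2 * pi :> R by rewrite mulr_gt0// pi_gt0.
pose L N (g : wiener nu) : mat nu :=
  rsum (fun t => cscale (polar 0 t ^+ k) (loop_eval g (polar 0 t))) 0 (2 * pi) (2 ^ N)
  - (2 * pi) *: g (- k%:Z).
suff : L N f @[N --> \oo] --> 0.
  move=> h; have {}h : L N f + (2 * pi) *: f (- k%:Z) @[N --> \oo]
      --> 0 + (2 * pi) *: f (- k%:Z) by apply: cvgD h _; exact: cvg_cst.
  rewrite add0r in h; apply: cvg_trans h; apply: near_eq_cvg; near=> N.
  by rewrite /L subrK.
apply: (@bounded_additive_cvg0 _ _ _ _ _ (2 * pi + 2 * pi)) => {f}.
- move=> N f g; rewrite /L [X in _ *: X](_ : _ = f (- k%:Z) + g (- k%:Z))//.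
  rewrite scalerDr opprD [RHS]addrACA; congr (_ + _).
  rewrite /rsum -scalerDr -big_split/=; congr (_ *: _); apply: eq_bigr => j _.
  by rewrite loop_evalD ?cscaleD//; exact: circle_polar.
- move=> N f; rewrite /L [leRHS]mulrDl; apply: le_trans (ler_normB _ _) _; apply: lerD.
    apply: norm_rsum => //; first exact: ltW.
    move=> t _; rewrite norm_cscale polarXn cabs_polar expR0 mul1r.
    by apply: norm_loop_eval; exact: circle_polar.
  rewrite normrZ gtr0_norm//; apply: ler_wpM2l; [exact: ltW|exact: wiener_norm_coef].
move=> i A; apply: cvg_near_cst.
(* From this rank on [2 ^ N] exceeds [|k + i|], so no aliasing occurs and the mean of the monomial
   is exact: its coefficient when [i = -k], and 0 otherwise. *)
exists `|(k%:Z + i)%R|%N => // N /= kN.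
have km : (`|(k%:Z + i)%R| < 2 ^ N)%N by apply: leq_ltn_trans kN (ltn_expl _ _).
have m0 : (0 < 2 ^ N)%N by rewrite expn_gt0.
rewrite /L.
have -> : rsum (fun t => cscale (polar 0 t ^+ k) (loop_eval (monomial i A) (polar 0 t)))
    0 (2 * pi) (2 ^ N) =
  (2 * pi / (2 ^ N)%:R) *: cscale (\sum_(j < 2 ^ N)
     polar 0 (j%:R * (2 * pi / (2 ^ N)%:R)) ^ (k%:Z + i)) A.
  rewrite /rsum; congr (_ *: _).
  rewrite [RHS]scaler_suml; apply: eq_bigr => j _.
  rewrite add0r loop_eval_monomial cscaleA exprnP -expfzDr//.
  apply/eqP => /(congr1 cabs)/eqP.
  by rewrite cabs_polar cabs0 expR0 oner_eq0.
rewrite /=; have [ik|ik] := eqVneq (- k%:Z) i.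
  rewrite -ik subrr; under eq_bigr do rewrite expr0z.
  rewrite sumr_const card_ord -[cscale _ _]/(cscale (((2 ^ N)%:R : R[i])) A).
  rewrite -(rmorph_nat (real_complex R)) -[cscale _ _]/((2 ^ N)%:R *: A).
  by rewrite scalerA mulfVK ?subrr// pnatr_eq0 -lt0n.
rewrite sum_polar//; last by rewrite addrC -[k%:Z]opprK subr_eq0 eq_sym.
rewrite [cscale 0 _]scale0r !scaler0 subrr.
by [].
Unshelve. all: by end_near. Qed.

(** The means of [z^k h(z)] over roots of unity have two limits that must agree: the coefficient, by
    [fourier_mean], and the value at the centre, by the mean value property. The case [k = 0] later
    turns the normalization at the centre into a condition on the coefficient 0. *)
Theorem disc_extension_coef (G : set (mat nu)) g (h : R[i]^o -> mat nu) (k : nat) :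
  disc_extension G (loop_eval g) h -> g (- k%:Z) = if k == 0 then h 0 else 0.
Proof.
move=> [hh _ ch hg].
have pi0 : 0 < 2 * pi :> R by rewrite mulr_gt0// pi_gt0.
have dX := @disc_functionX _ _ _ h k (conj hh ch).
have := disc_mean_value dX; have := @fourier_mean g k.
have -> : (fun t : R => cscale (polar 0 t ^+ k) (loop_eval g (polar 0 t))) =
   (fun t : R => cscale (polar 0 t ^+ k) (h (polar 0 t))).
  by apply/funext => t; rewrite hg//; exact: circle_polar.
move=> h1 h2.
have : (2 * pi) *: g (- k%:Z) = (2 * pi) *: cscale (0 ^+ k) (h 0).
  by apply: (cvg_unique _ h1 h2); exact: norm_hausdorff.
move/eqP; rewrite -subr_eq0 -scalerBr scaler_eq0 (gt_eqF pi0)/= subr_eq0 => /eqP ->.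
case: k {dX h1 h2} => [|k]; first by rewrite expr0 cscale1.
by rewrite exprS mul0r [LHS]scale0r.
Qed.

End Fourier.

(** * Inversion of the loop parameter, laws of the loop product and supports of coefficients *)

Section Flip.
Context {R : realType} {n : nat} {nu : matrix_norm R n}.
Implicit Types f g h : wiener nu.

Let flip_summable f : summable setT (fun i => `|f (- i)|%:E).
Proof.
rewrite summable_nonneg//.
have := esum_reflect 0 (u := fun i => `|f i|%:E) (fun i => normr_ge0 (f i)).
under eq_esum do rewrite sub0r.
by move=> ->; exact: wiener_fin.
Qed.

(** The substitution of [1/z] for [z]. It exchanges the two discs and respects products, so
    statements about negative loops reduce to positive ones. *)
Definition flip f : wiener nu := Wiener (flip_summable f).

Lemma zsum_opp (u : int -> mat nu) : zsum (fun i => u (- i)) = zsum u.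
Proof.
rewrite /zsum; congr (lim (_ @ \oo)); apply/funext => m.
rewrite (reindex_inj rev_ord_inj)/=; apply: eq_bigr => i _; congr u.
by have := ltn_ord i; rewrite subSS; lia.
Qed.

Lemma loop_eval_flip f z : loop_eval (flip f) z = loop_eval f z^-1.
Proof.
rewrite /loop_eval -[RHS]zsum_opp; congr zsum; apply/funext => i /=.
by rewrite exprz_inv opprK.
Qed.

Lemma flipK f : flip (flip f) = f.
Proof. by apply: wienerP => i /=; rewrite opprK. Qed.

Lemma circle_inv (z : R[i]^o) : circle z -> circle (z^-1 : R[i]^o).
Proof. by rewrite /circle/= normfV => ->; rewrite invr1. Qed.

Lemma loop_eval_coef_inj f g :
  (forall z, circle z -> loop_eval f z = loop_eval g z) ->
  forall k : nat, f (- k%:Z) = g (- k%:Z).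
Proof.
move=> fg k; have pi0 : 0 < 2 * pi :> R by rewrite mulr_gt0// pi_gt0.
have := @fourier_mean _ _ _ f k; have := @fourier_mean _ _ _ g k.
have -> : (fun t : R => cscale (polar 0 t ^+ k) (loop_eval g (polar 0 t))) =
   (fun t : R => cscale (polar 0 t ^+ k) (loop_eval f (polar 0 t))).
  by apply/funext => t; rewrite fg//; exact: circle_polar.
move=> h1 h2.
have : (2 * pi) *: f (- k%:Z) = (2 * pi) *: g (- k%:Z).
  by apply: (cvg_unique _ h2 h1); exact: norm_hausdorff.
by move/eqP; rewrite -subr_eq0 -scalerBr scaler_eq0 (gt_eqF pi0)/= subr_eq0 => /eqP.
Qed.

Lemma loop_eval_inj f g :
  (forall z, circle z -> loop_eval f z = loop_eval g z) -> f = g.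
Proof.
move=> fg; apply: wienerP => -[k|k]; last by rewrite NegzE; exact: loop_eval_coef_inj.
(* The means only reach indices at most 0; the remaining ones are read off the flipped loops. *)
have := @loop_eval_coef_inj (flip f) (flip g) _ k; rewrite /= opprK; apply=> z cz.
by rewrite !loop_eval_flip; apply: fg; exact: circle_inv.
Qed.

Lemma loop_eval1 z : loop_eval (loop_one nu) z = 1.
Proof. by rewrite /loop_one const_loopE loop_eval_monomial expr0z cscale1. Qed.

Lemma loop_mulA f g h : loop_mul f (loop_mul g h) = loop_mul (loop_mul f g) h.
Proof. by apply: loop_eval_inj => z cz; rewrite !loop_eval_mul// mulrA. Qed.

Lemma loop_mul1l f : loop_mul (loop_one nu) f = f.
Proof. by apply: loop_eval_inj => z cz; rewrite loop_eval_mul// loop_eval1 mul1r. Qed.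

Lemma loop_mul1r f : loop_mul f (loop_one nu) = f.
Proof. by apply: loop_eval_inj => z cz; rewrite loop_eval_mul// loop_eval1 mulr1. Qed.

Lemma flip_mul f g : flip (loop_mul f g) = loop_mul (flip f) (flip g).
Proof.
apply: loop_eval_inj => z cz; rewrite loop_eval_mul// !loop_eval_flip loop_eval_mul//.
exact: circle_inv.
Qed.

Lemma flip1 : flip (loop_one nu) = loop_one nu.
Proof. by apply: loop_eval_inj => z cz; rewrite loop_eval_flip !loop_eval1. Qed.

Definition inverse_loops f g :=
  loop_mul f g = loop_one nu /\ loop_mul g f = loop_one nu.

(** [loop_inv] is a choice among two-sided inverses; by associativity there is at most one. *)
Lemma loop_invE f g : inverse_loops f g -> loop_inv f = g.
Proof.
move=> fg; have [fi _] : inverse_loops f (loop_inv f) by apply: getPex; exists g.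
by rewrite -[LHS]loop_mul1l -fg.2 -loop_mulA fi loop_mul1r.
Qed.

(** The bound [m] is included, so [vanish_ge 1] leaves the frequencies at most 0, and
    [vanish_le (-1)] those at least 0. *)
Definition vanish_ge (m : int) f := forall k, m <= k -> f k = 0.
Definition vanish_le (m : int) f := forall k, k <= m -> f k = 0.

Lemma loop_mul_coef0 f g k :
  (forall i, f i = 0 \/ g (k - i) = 0) -> loop_mul f g k = 0.
Proof.
move=> h; rewrite -[RHS]zsum0; congr zsum; apply/funext => i.
by case: (h i) => ->; rewrite ?mul0r ?mulr0.
Qed.

(** The top frequencies [m - 1] and [p - 1] add up to [m + p - 2], and the product vanishes from the
    next index on. *)
Lemma vanish_ge_mul m p f g : vanish_ge m f -> vanish_ge p g ->
  vanish_ge (m + p - 1) (loop_mul f g).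
Proof.
move=> fm gp k kmp; apply: loop_mul_coef0 => i.
by case: (lerP m i) => mi; [left; exact: fm|right; apply: gp; lia].
Qed.

Lemma vanish_le_flip m f : vanish_le m f <-> vanish_ge (- m) (flip f).
Proof.
split=> h k km /=; first by apply: h; lia.
by have := h (- k); rewrite /= opprK; apply; lia.
Qed.

Lemma vanish_le_mul m p f g : vanish_le m f -> vanish_le p g ->
  vanish_le (m + p + 1) (loop_mul f g).
Proof.
move=> /vanish_le_flip fm /vanish_le_flip gp; apply/vanish_le_flip.
rewrite flip_mul; have := vanish_ge_mul fm gp.
by rewrite -!opprD.
Qed.

Lemma vanish_geD m f g : vanish_ge m f -> vanish_ge m g -> vanish_ge m (f - g).
Proof. by move=> fm gm k mk; rewrite /= fm// gm// subrr. Qed.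

Lemma vanish_leD m f g : vanish_le m f -> vanish_le m g -> vanish_le m (f - g).
Proof. by move=> fm gm k mk; rewrite /= fm// gm// subrr. Qed.

(* The quotient [p'^-1 p = m' m^-1] has neither negative nor positive
   frequencies, so it is constant, and the constant is read off at [0]. *)
Lemma birkhoff_factor_unique p p' q m m' r :
  vanish_le (-1) p -> vanish_le (-1) p' -> vanish_le (-1) q ->
  vanish_ge 1 m' -> vanish_ge 1 r -> p 0 = 1 -> p' 0 = 1 ->
  inverse_loops p' q -> inverse_loops m r ->
  loop_mul p m = loop_mul p' m' -> p = p'.
Proof.
move=> vp vp' vq vm' vr p0 p'0 [p'q qp'] [mr rm] pm.
pose x := loop_mul q p.
have xE : x = loop_mul m' r.
  rewrite /x -[p]loop_mul1r -mr 2!loop_mulA -(loop_mulA q) pm.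
  by rewrite !loop_mulA qp' loop_mul1l.
have pE : p = loop_mul p' x by rewrite /x loop_mulA p'q loop_mul1l.
have vx : vanish_le (-1) x by exact: (vanish_le_mul vq vp).
have vx' : vanish_ge 1 x by rewrite xE; exact: (vanish_ge_mul vm' vr).
have xc : x = monomial 0 (x 0).
  apply: wienerP => k /=; case: (ltgtP k 0) => [k0|k0|->//].
    by apply: vx; lia.
  by apply: vx'; lia.
suff x0 : x 0 = 1.
  by rewrite pE xc x0 -const_loopE loop_mul1r.
(* Against a constant loop only the coefficient of [p'] at 0 contributes, and that is 1. *)
have : loop_mul p' (monomial 0 (x 0)) 0 = x 0.
  rewrite -[RHS](zsum_single 0) /= /Defs.convolution.
  congr zsum; apply/funext => i /=; rewrite sub0r oppr_eq0.
  by have [->|_] := eqVneq i 0; rewrite ?p'0 ?mul1r ?mulr0.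
by rewrite -xc -pE p0.
Qed.

End Flip.

(** * Loops extending to the disc *)

Section HolomorphicInverse.
Context {R : realType}.

Lemma derivable_bigsum (I : Type) (s : seq I) (F : I -> R[i]^o -> R[i]^o) z :
  (forall i, derivable (F i) z 1) ->
  derivable (fun w => \sum_(i <- s) F i w : R[i]^o) z 1.
Proof.
move=> dF; elim: s => [|i s IH].
  by under eq_fun do rewrite big_nil; exact: derivable_cst.
have -> : (fun w => \sum_(j <- i :: s) F j w : R[i]^o) =
    F i + (fun w => \sum_(j <- s) F j w : R[i]^o).
  by apply/funext => w; rewrite big_cons.
exact: (@derivableD R[i] R[i]^o R[i]^o (F i) _ z 1 (dF i) IH).
Qed.

Lemma derivable_bigprod (I : Type) (s : seq I) (F : I -> R[i]^o -> R[i]^o) z :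
  (forall i, derivable (F i) z 1) ->
  derivable (fun w => \prod_(i <- s) F i w : R[i]^o) z 1.
Proof.
move=> dF; elim: s => [|i s IH].
  by under eq_fun do rewrite big_nil; exact: derivable_cst.
have -> : (fun w => \prod_(j <- i :: s) F j w : R[i]^o) =
    F i * (fun w => \prod_(j <- s) F j w : R[i]^o).
  by apply/funext => w; rewrite big_cons.
exact: (@derivableM R[i] R[i]^o (F i) _ z 1 (dF i) IH).
Qed.

Lemma derivable_det m (M : R[i]^o -> 'M[R[i]]_m) z :
  (forall j k, derivable (fun w => M w j k : R[i]^o) z 1) ->
  derivable (fun w => \det (M w) : R[i]^o) z 1.
Proof.
move=> dM; rewrite /determinant; apply: derivable_bigsum => s.
have dprod := @derivable_bigprod _ (index_enum 'I_m) (fun j w => M w j (s j)) z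
  (fun j => dM j (s j)).
exact: (@derivableM R[i] R[i]^o (cst _) _ z 1 (@derivable_cst _ _ _ _ _ _) dprod).
Qed.

(** Cramer's rule: the entry is a cofactor divided by the determinant, both polynomial in the
    entries of [M]. *)
Lemma derivable_inv_entry m (M : R[i]^o -> 'M[R[i]]_m) z j k :
  (forall j k, derivable (fun w => M w j k : R[i]^o) z 1) -> \det (M z) != 0 ->
  derivable (fun w => ((\det (M w))^-1 *: \adj (M w)) j k : R[i]^o) z 1.
Proof.
move=> dM dz.
have -> : (fun w => ((\det (M w))^-1 *: \adj (M w)) j k : R[i]^o) =
  (fun w => (\det (M w))^-1 : R[i]^o) *
  (cst ((-1) ^+ (k + j)) * (fun w => \det (row' k (col' j (M w))) : R[i]^o)).
  by apply/funext => w; rewrite !mxE.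
have dcof : derivable (fun w => \det (row' k (col' j (M w))) : R[i]^o) z 1.
  apply: derivable_det => j' k'.
  by under eq_fun do rewrite !mxE; exact: dM.
have dinv : derivable (fun w => (\det (M w))^-1 : R[i]^o) z 1.
  exact: (@derivableV R[i] R[i]^o _ z 1 dz (derivable_det dM)).
apply: (@derivableM R[i] R[i]^o _ _ z 1 dinv).
exact: (@derivableM R[i] R[i]^o (cst _) _ z 1 (@derivable_cst _ _ _ _ _ _) dcof).
Qed.

End HolomorphicInverse.

(** * Products and inverses of loops that extend to a disc *)

Section LoopGroupClosure.
Context {R : realType} {n : nat} {nu : matrix_norm R n}.
Implicit Types (G : set (mat nu)) (f g h : wiener nu).

Definition minv (A : mat nu) : mat nu := invmx (A : 'M[R[i]]_n).

Lemma mulmV (A : mat nu) : GL A -> A * minv A = 1.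
Proof. exact: mulmxV. Qed.

Lemma mulVm (A : mat nu) : GL A -> minv A * A = 1.
Proof. exact: mulVmx. Qed.

(** From [A^-1 - B^-1 = A^-1 (B - A) B^-1]; the smallness of [A - B] lets half of [|B^-1|] be
    absorbed, giving [|B^-1| <= 2 |A^-1|]. *)
Lemma norm_minvB (A B : mat nu) : GL A -> GL B ->
  `|A - B| * `|minv A| <= 1 / 2 ->
  `|minv A - minv B| <= 2 * `|minv A| ^+ 2 * `|A - B|.
Proof.
move=> uA uB AB.
have E : minv A - minv B = minv A * ((B - A) * minv B).
  by rewrite mulrBl mulmV// mulrBr mulr1 mulrA mulVm// mul1r.
have nE : `|minv A - minv B| <= `|minv A| * (`|A - B| * `|minv B|).
  rewrite E (distrC A B); apply: le_trans (mat_normM _ _) _.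
  by rewrite ler_wpM2l// mat_normM.
have nB : `|minv B| <= 2 * `|minv A|.
  have : `|minv B| <= `|minv A| + `|minv A - minv B|.
    rewrite -{1}[minv B](subKr (minv A)); exact: ler_normB.
  have : `|minv A| * (`|A - B| * `|minv B|) <= 1 / 2 * `|minv B|.
    by rewrite mulrA ler_wpM2r// mulrC.
  by move: nE; lra.
apply: le_trans nE _.
rewrite [leRHS](_ : _ = `|minv A| * (`|A - B| * (2 * `|minv A|))); last by ring.
by rewrite !ler_wpM2l.
Qed.

Lemma cvg_minv (T : Type) (F : set_system T) {FF : Filter F}
    (u : T -> mat nu) (A : mat nu) :
  GL A -> (\forall t \near F, GL (u t)) -> u @ F --> A ->
  (fun t => minv (u t)) @ F --> minv A.
Proof.
move=> uA uu /cvgrPdist_le uF; apply/cvgrPdist_le => e e0.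
pose c := `|minv A| + 1.
have c0 : 0 < c by rewrite ltr_wpDl.
(* The first bound secures the smallness hypothesis of [norm_minvB], the second turns its conclusion
   into [e]. *)
have d0 : 0 < Num.min (1 / 2 / c) (e / (2 * c ^+ 2)).
  by rewrite lt_min !divr_gt0// mulr_gt0// exprn_gt0.
apply: filterS2 uu (uF _ d0) => t ut.
rewrite le_min => /andP[h1 h2].
have nc : `|minv A| <= c by rewrite lerDl.
apply: le_trans (norm_minvB _ _ _) _ => //.
  apply: (@le_trans _ _ (1 / 2 / c * c)); first exact: ler_pM.
  by rewrite mulfVK// gt_eqF.
apply: (@le_trans _ _ (2 * c ^+ 2 * (e / (2 * c ^+ 2)))).
  apply: ler_pM => //; rewrite ?mulr_ge0// ?exprn_ge0//.
  by rewrite ler_wpM2l// lerXn2r// nnegrE// ltW.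
by rewrite mulrCA divff ?mulr1// gt_eqF// mulr_gt0// exprn_gt0.
Qed.

Lemma open_disc_open (z : R[i]^o) : open_disc z ->
  exists2 d : R, 0 < d & forall w : R[i]^o, cabs (w - z) < d -> open_disc w.
Proof.
move=> /open_discE z1; exists (1 - cabs z); first by rewrite subr_gt0.
move=> w; rewrite ltrBrDr => wz; apply/open_discE; apply: le_lt_trans wz.
by rewrite -{1}[w](subrK z) cabsD.
Qed.

Lemma disc_extensionM G (u v f g : R[i]^o -> mat nu) : matrix_group G ->
  disc_extension G u f -> disc_extension G v g ->
  disc_extension G (fun z => u z * v z) (fun z => f z * g z).
Proof.
move=> [_ _ GM _ _] [hf Gf cf fu] [hg Gg cg gv].
have [hfg cfg] := disc_functionM (conj hf cf) (conj hg cg).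
split => //; first by move=> z Dz; apply: GM; [exact: Gf|exact: Gg].
by move=> z Dz; rewrite fu// gv.
Qed.

Lemma disc_extensionV G (u f : R[i]^o -> mat nu) : matrix_group G ->
  (forall z, circle z -> G (u z)) -> disc_extension G u f ->
  disc_extension G (fun z => minv (u z)) (fun z => minv (f z)).
Proof.
move=> [GU _ _ GV _] Gu [hf Gf cf fu].
(* Inside the disc [f] takes values in [G]; on the boundary it agrees with [u], which does as
   well. *)
have fU z : closed_disc z -> GL (f z).
  move=> /closed_discE; rewrite le_eqVlt => /predU1P[/circleE cz|/open_discE oz].
    by rewrite fu//; apply: GU; exact: Gu.
  by apply: GU; exact: Gf.
split.
- move=> z oz j k.
  have dz : \det (f z : 'M[R[i]]_n) != 0.
    by have := GU _ (Gf _ oz); rewrite /GL/= unitmxE unitfE.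
  (* [invmx] is the adjugate formula only at invertible matrices, so the two functions are compared
     on a neighbourhood inside the disc. *)
  apply: near_eq_derivable (@derivable_inv_entry _ _ f z j k (hf z oz) dz).
  have [d d0 dP] := open_disc_open oz.
  apply/nbhs_cabs; exists d => // w /dP ow.
  have := fU w; rewrite closed_discE => /(_ (ltW (iffLR (open_discE _) ow))).
  by rewrite /minv /invmx /GL/= => ->.
- by move=> z oz; apply: GV; exact: Gf.
- have /subspace_continuousP {}cf := cf.
  apply/subspace_continuousP => z cz; apply: cvg_minv; [exact: fU| |exact: cf].
  by rewrite near_withinE; near=> w; exact: fU.
- by move=> z cz; rewrite fu.
Unshelve. all: by end_near. Qed.

Lemma LambdaG_mul G f g : matrix_group G -> LambdaG G f -> LambdaG G g ->
  LambdaG G (loop_mul f g).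
Proof.
by move=> [_ _ GM _ _] Gf Gg z cz; rewrite loop_eval_mul//;
  apply: GM; [exact: Gf|exact: Gg].
Qed.

Lemma loop_eval_inverse G g h z : matrix_group G -> LambdaG G g ->
  inverse_loops g h -> circle z -> loop_eval h z = minv (loop_eval g z).
Proof.
move=> [GU _ _ _ _] Gg [gh _] cz; have gU := GU _ (Gg z cz).
by rewrite -[LHS]mul1r -(mulVm gU) -mulrA -loop_eval_mul// gh loop_eval1 mulr1.
Qed.

Lemma LambdaG_inverse G g h : matrix_group G -> LambdaG G g ->
  inverse_loops g h -> LambdaG G h.
Proof.
move=> mG Gg gh z cz; rewrite (loop_eval_inverse mG Gg gh cz).
by have [_ _ _ GV _] := mG; apply: GV; exact: Gg.
Qed.

Lemma LambdaP_mul G f g : matrix_group G -> LambdaP G f -> LambdaP G g ->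
  LambdaP G (loop_mul f g).
Proof.
move=> mG [Gf [f' ef]] [Gg [g' eg]]; split; first exact: LambdaG_mul.
exists (fun z => f' z * g' z).
have [hfg Gfg cfg fgE] := disc_extensionM mG ef eg.
by split => // z cz; rewrite fgE// loop_eval_mul.
Qed.

Lemma LambdaP_inverse G g h : matrix_group G -> LambdaP G g ->
  inverse_loops g h -> LambdaP G h.
Proof.
move=> mG [Gg [g' eg]] gh; split; first exact: LambdaG_inverse gh.
exists (fun z => minv (g' z)).
have [hg' Gg' cg' gE] := disc_extensionV mG Gg eg.
by split => // z cz; rewrite gE// (loop_eval_inverse mG Gg gh).
Qed.

Lemma LambdaP_vanish G g : LambdaP G g -> vanish_le (-1) g.
Proof.
move=> [_ [g' eg]] k k0; have -> : k = - `|k|%N%:Z by lia.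
by rewrite (disc_extension_coef _ eg); case: eqP => //; lia.
Qed.

Lemma LambdaP1P G g : LambdaP1 G g -> LambdaP G g.
Proof. by move=> [Gg [f [ef _]]]; split => //; exists f. Qed.

Lemma LambdaP1_coef0 G g : LambdaP1 G g -> g 0 = 1.
Proof. by move=> [_ [f [ef f0]]]; rewrite -[0]oppr0 (disc_extension_coef 0 ef). Qed.

Lemma LambdaG_flip G g : LambdaG G (flip g) <-> LambdaG G g.
Proof.
suff h f : LambdaG G f -> LambdaG G (flip f) by split=> /h //; rewrite flipK.
by move=> Gf z cz; rewrite loop_eval_flip; apply: Gf; exact: circle_inv.
Qed.

Lemma eval_flip g : (fun z => loop_eval g z^-1) = loop_eval (flip g).
Proof. by apply/funext => z; rewrite loop_eval_flip. Qed.

Lemma LambdaM_flip G g : LambdaM G g <-> LambdaP G (flip g).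
Proof. by rewrite /LambdaM /LambdaP /= eval_flip LambdaG_flip. Qed.

Lemma LambdaM1_flip G g : LambdaM1 G g <-> LambdaP1 G (flip g).
Proof. by rewrite /LambdaM1 /LambdaP1 /= eval_flip LambdaG_flip. Qed.

Lemma inverse_loops_flip f g : inverse_loops f g -> inverse_loops (flip f) (flip g).
Proof. by move=> [fg gf]; split; rewrite -flip_mul ?fg ?gf flip1. Qed.

Lemma LambdaM_mul G f g : matrix_group G -> LambdaM G f -> LambdaM G g ->
  LambdaM G (loop_mul f g).
Proof.
move=> mG /LambdaM_flip Mf /LambdaM_flip Mg; apply/LambdaM_flip.
by rewrite flip_mul; exact: LambdaP_mul.
Qed.

Lemma LambdaP1_one G : matrix_group G -> LambdaP1 G (loop_one nu).
Proof.
move=> [_ G1 _ _ _]; split; first by move=> z _; rewrite loop_eval1.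
have [h1 c1] : disc_function (fun _ : R[i]^o => 1 : mat nu).
  have := @disc_function_exprn R n nu 0.
  by congr disc_function; apply/funext => z; rewrite expr0 cscale1.
by exists (fun=> 1); split => //; split => // z _; rewrite loop_eval1.
Qed.

End LoopGroupClosure.

(** * Maurer-Cartan forms of the factors *)

Section SmoothMaps.
Context {R : realType} {U : manifold R}.

Lemma smooth_map_differentiable (E : normedModType R) (F : U -> E) i x :
  smooth_map F -> (mchart i @` mdom i) x -> differentiable (F \o @mparam R U i) x.
Proof. by move=> /(_ i 1%N)[dF _] /dF. Qed.

(** Analyticity along [N] supplies only local extensions [h] of [g]; on the open preimage of the
    domain of [h] in a chart, [g \o F] is an ordinary composition, and [Ck_local] glues. *)
Lemma smooth_map_analytic_comp (E K : normedModType R) (F : U -> E)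
    (N : set E) (g : E -> K) :
  smooth_map F -> (forall t, N (F t)) -> analytic_along N g -> smooth_map (g \o F).
Proof.
move=> sF NF gN i k.
have oA : open (mchart i @` mdom i) := @m_open_image R U i.
have cF x : (mchart i @` mdom i) x -> {for x, continuous (F \o @mparam R U i)}.
  by move=> Ax; exact: (sF i 0%N x Ax).
apply: Ck_local => x Ax.
have [V [h [oV Vx [sh _] gh]]] := gN _ (NF (mparam i x)).
exists ((mchart i @` mdom i) `&` (F \o @mparam R U i) @^-1` V),
  (h \o (F \o @mparam R U i)).
have oW : open ((mchart i @` mdom i) `&` (F \o @mparam R U i) @^-1` V).
  rewrite openE => y [Ay Vy]; apply: filterI; first exact: open_nbhs_nbhs.
  by apply: (cF y Ay); exact: open_nbhs_nbhs.
split => //.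
- apply: (@Ck_comp _ _ _ _ _ _ V) => //; first by move=> y [].
  by apply: Ck_sub (sF i k) => y [].
- by move=> y [Ay Vy] /=; rewrite gh.
Qed.

End SmoothMaps.

(** * Differential calculus in the loop algebra *)

Section LoopCalculus.
Context {R : realType} {n : nat} {nu : matrix_norm R n}.
Implicit Types E : normedModType R.

Lemma loop_mul_is_bilinear : bilinear_for
  (GRing.Scale.Law.clone _ _ *:%R _) (GRing.Scale.Law.clone _ _ *:%R _)
  (@loop_mul R n nu).
Proof.
split=> [g|f] a x y /=.
- by rewrite loop_mulDl loop_mulZl.
- by rewrite loop_mulDr loop_mulZr.
Qed.

HB.instance Definition _ := bilinear_isBilinear.Build R (wiener nu) (wiener nu)
  (wiener nu) _ _ (@loop_mul R n nu) loop_mul_is_bilinear.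

Lemma loop_mul_continuous :
  continuous (fun p : wiener nu * wiener nu => loop_mul p.1 p.2).
Proof.
apply: bounded_bilinear_continuous.
- exact: loop_mulDl.
- exact: loop_mulDr.
- exact: norm_loop_mul.
Qed.

Lemma smooth_map_mul (U : manifold R) (F K : U -> wiener nu) :
  smooth_map F -> smooth_map K -> smooth_map (fun t => loop_mul (F t) (K t)).
Proof.
move=> sF sK i k.
apply: (@Ck_bilin _ k _ _ _ _ _ (@loop_mul R n nu) (F \o mparam i) (K \o mparam i)).
- exact: m_open_image.
- exact: loop_mul_continuous.
- exact: sF.
- exact: sK.
Qed.

Lemma diff_loop_mul E (f g : E -> wiener nu) x v :
  differentiable f x -> differentiable g x ->
  'd (fun y => loop_mul (f y) (g y)) x v =
  loop_mul (f x) ('d g x v) + loop_mul ('d f x v) (g x).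
Proof.
move=> df dg.
have h := @is_diff_bilin R E _ _ _ (@loop_mul R n nu) f g x loop_mul_continuous df dg.
exact: (congr1 (@^~ v) (@diff_val _ _ _ _ _ _ _ h)).
Qed.

(** Extracting a coefficient is linear and continuous, hence commutes with the differential;
    constraints on the coefficients of a map thus pass to its derivative. *)
Lemma diff_coef_cst E (f : E -> wiener nu) x v k (A : mat nu) :
  differentiable f x -> (forall y, f y k = A) -> ('d f x v : wiener nu) k = 0.
Proof.
move=> df fA.
have lin : linear (fun g : wiener nu => g k : mat nu) by [].
pose LM := GRing.isLinear.Build _ _ _ _ _ lin.
pose L : {linear wiener nu -> mat nu} :=
  HB.pack (fun g : wiener nu => g k : mat nu) LM.
have cL : continuous L.
  apply: (@lipschitz_continuous R _ _ _ 1) => [//|g]; rewrite mul1r.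
  exact: wiener_norm_coef.
have : 'd (L \o f) x v = 0.
  have -> : L \o f = cst A by apply/funext => y; exact: fA.
  by rewrite diff_cst.
have dL : differentiable L (f x) by exact: linear_differentiable.
by rewrite (diff_comp df dL) /= (diff_lin _ cL).
Qed.

Lemma inverse_loops_mul (f f' g g' : wiener nu) :
  inverse_loops f f' -> inverse_loops g g' ->
  inverse_loops (loop_mul f g) (loop_mul g' f').
Proof.
move=> [ff' f'f] [gg' g'g]; split.
  by rewrite -loop_mulA (loop_mulA g) gg' loop_mul1l.
by rewrite -loop_mulA (loop_mulA f') f'f loop_mul1l.
Qed.

(** The algebraic content of a gauge change, the product rule expression [p dm + dp m] standing for
    the differential of [p m]. *)
Lemma gauge_identity (p p' m m' dp dm : wiener nu) :
  inverse_loops p p' -> inverse_loops m m' ->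
  loop_mul p' dp =
  loop_mul (loop_mul m (loop_mul (loop_mul m' p')
    (loop_mul p dm + loop_mul dp m))) m' -
  loop_mul dm m'.
Proof.
move=> [pp' p'p] [mm' m'm].
rewrite -(loop_mulA m') (loop_mulA m m') mm' loop_mul1l.
rewrite loop_mulDr (loop_mulA p' p) p'p loop_mul1l loop_mulDl.
by rewrite addrC addKr !loop_mulA -loop_mulA mm' loop_mul1r.
Qed.

(* Gauge change: [f = p m] gives [p^-1 dp = m (f^-1 df) m^-1 - dm m^-1]. *)
Lemma gauge_change E (p m : E -> wiener nu) x v p' m' :
  differentiable p x -> differentiable m x ->
  inverse_loops (p x) p' -> inverse_loops (m x) m' ->
  loop_mul p' ('d p x v) =
  loop_mul (loop_mul (m x) (loop_mul (loop_mul m' p')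
     ('d (fun y => loop_mul (p y) (m y)) x v))) m' -
  loop_mul ('d m x v) m'.
Proof.
move=> dp dm ip im; have h := diff_loop_mul v dp dm.
have g := gauge_identity ('d p x v) ('d m x v) ip im.
exact: (etrans g (congr1 (fun w => loop_mul (loop_mul (m x)
  (loop_mul (loop_mul m' p') w)) m' - loop_mul ('d m x v) m') (esym h))).
Qed.

End LoopCalculus.

(** * Connection orders of the Birkhoff factors *)

Section ConnectionOrder.
Context {R : realType} {n : nat} {nu : matrix_norm R n} {U : manifold R}.
Implicit Types F P M : U -> wiener nu.

(** The inverse is constrained too, because it enters the Maurer-Cartan form. *)
Definition plus_map P :=
  [/\ smooth_map P, (forall t, vanish_le (-1) (P t)) &
      forall t, exists2 p', inverse_loops (P t) p' & vanish_le (-1) p'].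

Definition minus_map M :=
  [/\ smooth_map M, (forall t, vanish_ge 1 (M t)) &
      forall t, exists2 m', inverse_loops (M t) m' & vanish_ge 1 m'].

Lemma plus_factor_order F P M (a b : \bar int) : (0 < b)%E ->
  plus_map P -> (forall t, P t 0 = 1) -> minus_map M ->
  (forall t, F t = loop_mul (P t) (M t)) ->
  connection_order a b F -> connection_order 1%E b P.
Proof.
move=> b0 [sP vP iP] P0 [sM vM iM] FPM oF i x v Ax k nk.
have dP := smooth_map_differentiable sP Ax.
have dM := smooth_map_differentiable sM Ax.
have [p' pp' vp'] := iP (mparam i x); have [m' mm' vm'] := iM (mparam i x).
(* The normalization makes the coefficient of index 0 constant, so the derivative starts at index
   1. *)
have vdP : vanish_le 0 ('d (P \o mparam i) x v).
  move=> j; rewrite le_eqVlt => /predU1P[->|j0].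
    by apply: (@diff_coef_cst _ _ _ _ _ x v 0 1 dP) => y; exact: P0.
  by apply: (@diff_coef_cst _ _ _ _ _ x v j 0 dP) => y; apply: vP; lia.
rewrite /maurer_cartan (loop_invE pp').
(* An index outside [[1, b]] is either at most 0, where positivity of [P] suffices, or greater than
   [b], where the gauge formula is needed. *)
have [k0|k0] := lerP k 0.
  exact: (vanish_le_mul vp' vdP).
have kb : ~~ (k%:E <= b)%E.
  by apply: contra nk => ->; rewrite andbT lee_fin; lia.
have vdM : vanish_ge 1 ('d (M \o mparam i) x v).
  by move=> j j1; apply: (@diff_coef_cst _ _ _ _ _ x v j 0 dM) => y; exact: vM.
have vF : vanish_ge k (maurer_cartan F i x v).
  move=> j kj; apply: oF => //; apply: contra kb => /andP[_].
  by apply: le_trans; rewrite lee_fin.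
have FE : F \o mparam i = fun y => loop_mul ((P \o mparam i) y) ((M \o mparam i) y).
  by apply/funext => y; exact: FPM.
rewrite (gauge_change v dP dM pp' mm').
apply: (@vanish_geD _ _ _ k) => //; last first.
  by move=> j kj; apply: (vanish_ge_mul vdM vm'); lia.
(* Multiplying on either side by a loop with frequencies at most 0 does not raise the top
   frequency. *)
have : vanish_ge (1 + k - 1 + 1 - 1) (loop_mul (loop_mul (M (mparam i x))
    (maurer_cartan F i x v)) m').
  by apply: vanish_ge_mul vm'; exact: vanish_ge_mul (vM _) vF.
have -> : 1 + k - 1 + 1 - 1 = k by lia.
rewrite /maurer_cartan FE.
have := inverse_loops_mul pp' mm'; rewrite -FPM => /loop_invE ->.
by [].
Qed.

(** The mirror image of [plus_factor_order]: here conjugation by [P] does not lower the bottom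
    frequency. *)
Lemma minus_factor_order F M P (a b : \bar int) : (a < 0)%E ->
  minus_map M -> (forall t, M t 0 = 1) -> plus_map P ->
  (forall t, F t = loop_mul (M t) (P t)) ->
  connection_order a b F -> connection_order a (-1)%E M.
Proof.
move=> a0 [sM vM iM] M0 [sP vP iP] FMP oF i x v Ax k nk.
have dP := smooth_map_differentiable sP Ax.
have dM := smooth_map_differentiable sM Ax.
have [p' pp' vp'] := iP (mparam i x); have [m' mm' vm'] := iM (mparam i x).
have vdM : vanish_ge 0 ('d (M \o mparam i) x v).
  move=> j; rewrite le_eqVlt => /predU1P[<-|j0].
    by apply: (@diff_coef_cst _ _ _ _ _ x v 0 1 dM) => y; exact: M0.
  by apply: (@diff_coef_cst _ _ _ _ _ x v j 0 dM) => y; apply: vM; lia.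
rewrite /maurer_cartan (loop_invE mm').
have [k0|k0] := lerP 0 k.
  exact: (vanish_ge_mul vm' vdM).
have ka : ~~ (a <= k%:E)%E.
  by apply: contra nk => ->; rewrite /= lee_fin; lia.
have vdP : vanish_le (-1) ('d (P \o mparam i) x v).
  by move=> j j1; apply: (@diff_coef_cst _ _ _ _ _ x v j 0 dP) => y; exact: vP.
have vF : vanish_le k (maurer_cartan F i x v).
  move=> j kj; apply: oF => //; apply: contra ka => /andP[+ _] => /le_trans; apply.
  by rewrite lee_fin.
have FE : F \o mparam i = fun y => loop_mul ((M \o mparam i) y) ((P \o mparam i) y).
  by apply/funext => y; exact: FMP.
rewrite (gauge_change v dM dP mm' pp').
apply: (@vanish_leD _ _ _ k) => //; last first.
  by move=> j kj; apply: (vanish_le_mul vdP vp'); lia.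
have : vanish_le (-1 + k + 1 + -1 + 1) (loop_mul (loop_mul (P (mparam i x))
    (maurer_cartan F i x v)) p').
  by apply: vanish_le_mul vp'; exact: vanish_le_mul (vP _) vF.
have -> : -1 + k + 1 + -1 + 1 = k by lia.
rewrite /maurer_cartan FE.
have := inverse_loops_mul mm' pp'; rewrite -FMP => /loop_invE ->.
by [].
Qed.

End ConnectionOrder.

(** * Uniqueness of pointwise Birkhoff factors *)

Section Uniqueness.
Context {R : realType} {n : nat} {nu : matrix_norm R n} {G : set (mat nu)}.
Hypothesis matrixG : matrix_group G.
Implicit Types p m : wiener nu.

Definition invertible_loop p := exists q, inverse_loops p q.

Lemma loop_mulI p m m' : invertible_loop p -> loop_mul p m = loop_mul p m' -> m = m'.
Proof.
by move=> [q [_ qp]] pm; rewrite -[m]loop_mul1l -qp -loop_mulA pm loop_mulA qp loop_mul1l.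
Qed.

Lemma plus_minus_unique p p' m m' :
  LambdaP1 G p -> LambdaP1 G p' -> LambdaM G m -> LambdaM G m' ->
  invertible_loop p' -> invertible_loop m ->
  loop_mul p m = loop_mul p' m' -> p = p' /\ m = m'.
Proof.
move=> Pp Pp' Mm Mm' ip' [r mr] pm.
have vM k : LambdaM G k -> vanish_ge 1 k.
  by move=> /LambdaM_flip /LambdaP_vanish; rewrite vanish_le_flip flipK opprK.
have [q p'q] := ip'.
have E : p = p'.
  apply: (birkhoff_factor_unique (q := q) (m := m) (m' := m') (r := r)) => //.
  - exact: LambdaP_vanish (LambdaP1P Pp).
  - exact: LambdaP_vanish (LambdaP1P Pp').
  - exact: LambdaP_vanish (LambdaP_inverse matrixG (LambdaP1P Pp') p'q).
  - exact: vM.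
  - apply/vM/LambdaM_flip; apply: LambdaP_inverse matrixG _ (inverse_loops_flip mr).
    exact: (iffLR (LambdaM_flip _ _) Mm).
  - exact: LambdaP1_coef0 Pp.
  - exact: LambdaP1_coef0 Pp'.
by split=> //; apply: (loop_mulI ip'); rewrite -pm E.
Qed.

Lemma minus_plus_unique p p' m m' :
  LambdaM1 G m -> LambdaM1 G m' -> LambdaP G p -> LambdaP G p' ->
  invertible_loop m' -> invertible_loop p ->
  loop_mul m p = loop_mul m' p' -> m = m' /\ p = p'.
Proof.
have iflip k : invertible_loop k -> invertible_loop (flip k).
  by move=> [q kq]; exists (flip q); exact: inverse_loops_flip.
have Mflip k : LambdaP G k -> LambdaM G (flip k) by rewrite LambdaM_flip flipK.
move=> /LambdaM1_flip Mm /LambdaM1_flip Mm' /Mflip Pp /Mflip Pp' /iflip im /iflip ip.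
move=> /(congr1 flip); rewrite !flip_mul.
move=> /(plus_minus_unique Mm Mm' Pp Pp' im ip)[/(congr1 flip) + /(congr1 flip)].
by rewrite !flipK.
Qed.

End Uniqueness.

Theorem proposition3p1 (R : realType) (n : nat) (nu : matrix_norm R n)
    (G : set (mat nu)) (hG : complex_semisimple_group G)
    (H : set (wiener nu)) (hH : birkhoff_subgroup G H)
    (U : manifold R) (a b : \bar int) (ha : (a < 0)%E) (hb : (0 < b)%E)
    (F : U -> wiener nu) (hF : maps_order H a b F)
    (hFB : forall t, big_cell G H (F t)) :
  (exists! GF : (U -> wiener nu) * (U -> wiener nu),
     normalized_pair G H a b GF.1 GF.2 /\
     exists Fm Gp, birkhoff_factors G H F GF.1 Gp GF.2 Fm) /\
  (forall t0 : U, F t0 = loop_one nu ->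
     forall Gm Gp Fp Fm : U -> wiener nu,
       normalized_pair G H a b Gm Fp -> birkhoff_factors G H F Gm Gp Fp Fm ->
       [/\ Fp t0 = loop_one nu, Fm t0 = loop_one nu,
           Gm t0 = loop_one nu & Gp t0 = loop_one nu]).
Proof.
have [matrixG _ _ _] := hG.
have [[_ [H1 HM HV] _ _] _ [_ _ RBd LBd]] := hH.
have [[sF HF] oF] := hF.
have inv g : H g -> invertible_loop g.
  by move=> /HV[h [_ gh hg]]; exists h.
have plusS g : plus_component G H g -> H g /\ LambdaP1 G g.
  by move/connected_component_sub.
have minusS g : minus_component G H g -> H g /\ LambdaM1 G g.
  by move/connected_component_sub.
have constS g : const_component G H g -> [/\ H g, LambdaP G g & LambdaM G g].
  by move/connected_component_sub => -[[]].
have M1M g : LambdaM1 G g -> LambdaM G g.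
  by move=> /LambdaM1_flip /LambdaP1P; rewrite LambdaM_flip.
have invP g q : LambdaP G g -> inverse_loops g q -> vanish_le (-1) q.
  by move=> Pg gq; exact: LambdaP_vanish (LambdaP_inverse matrixG Pg gq).
have vM g : LambdaM G g -> vanish_ge 1 g.
  by move=> /LambdaM_flip /LambdaP_vanish; rewrite vanish_le_flip flipK opprK.
have invM g q : LambdaM G g -> inverse_loops g q -> vanish_ge 1 q.
  move=> /LambdaM_flip Mg /inverse_loops_flip gq; apply/vM/LambdaM_flip.
  exact: LambdaP_inverse Mg gq.
have M10 g : LambdaM1 G g -> g 0 = 1.
  by move=> /LambdaM1_flip /LambdaP1_coef0.
(* The comparison is pointwise and covers factors anywhere in [H], not only in the identity
   components from which existence draws them. *)
have uniq Gm Gp Fp Fm Gm' Gp' Fp' Fm' :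
    normalized_pair G H a b Gm Fp -> birkhoff_factors G H F Gm Gp Fp Fm ->
    normalized_pair G H a b Gm' Fp' -> birkhoff_factors G H F Gm' Gp' Fp' Fm' ->
    Gm = Gm' /\ Fp = Fp'.
  move=> [_ _ nGm nFp] [[_ hFm] [_ hGp] FE1 FE2].
  move=> [_ _ nGm' nFp'] [[_ hFm'] [_ hGp'] FE1' FE2'].
  split; apply/funext => t.
    have [HGm MGm] := nGm t; have [HGm' MGm'] := nGm' t.
    have [HGp PGp] := hGp t; have [HGp' PGp'] := hGp' t.
    apply: (proj1 (minus_plus_unique matrixG MGm MGm' PGp PGp'
      (inv _ HGm') (inv _ HGp) _)).
    by rewrite -FE2 -FE2'.
  have [HFp PFp] := nFp t; have [HFp' PFp'] := nFp' t.
  have [HFm MFm] := hFm t; have [HFm' MFm'] := hFm' t.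
  apply: (proj1 (plus_minus_unique matrixG PFp PFp' MFm MFm'
    (inv _ HFp') (inv _ HFm) _)).
  by rewrite -FE1 -FE1'.
split; last first.
  move=> t0 Ft0 Gm Gp Fp Fm [_ _ nGm nFp] [[_ hFm] [_ hGp] FE1 FE2].
  (* At [t0] the value also factors as [1 * 1], so uniqueness of the pointwise factors forces all
     four to be 1. *)
  have P1 := LambdaP1_one matrixG.
  have M1 : LambdaM1 G (loop_one nu) by apply/LambdaM1_flip; rewrite flip1.
  have i1 : invertible_loop (loop_one nu) := inv _ H1.
  have [HGm MGm] := nGm t0; have [HGp PGp] := hGp t0.
  have [HFp PFp] := nFp t0; have [HFm MFm] := hFm t0.
  have [-> ->] := plus_minus_unique matrixG PFp P1 MFm (M1M _ M1) i1 (inv _ HFm)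
    (etrans (esym (FE1 t0)) (etrans Ft0 (esym (loop_mul1l _)))).
  have [-> ->] := minus_plus_unique matrixG MGm M1 PGp (LambdaP1P P1) i1 (inv _ HGp)
    (etrans (esym (FE2 t0)) (etrans Ft0 (esym (loop_mul1l _)))).
  by [].
have cfst (V W : normedModType R) : continuous (@fst V W) by move=> ?; exact: cvg_fst.
have csnd (V W : normedModType R) : continuous (@snd V W) by move=> ?; exact: cvg_snd.
(* The multiplication map of a cell has a left inverse that is analytic along the cell; composed
   with [F] it yields the three factors as smooth maps. *)
have split3 A B C :
    analytic_diffeo (triples A B C) (birkhoff_cell A B C) (@triple_mul R n nu) ->
    (forall t, birkhoff_cell A B C (F t)) ->
    exists X Y Z : U -> wiener nu, [/\
      smooth_map X /\ (forall t, A (X t)), smooth_map Y /\ (forall t, B (Y t)),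
      smooth_map Z /\ (forall t, C (Z t)) &
      forall t, F t = loop_mul (loop_mul (X t) (Y t)) (Z t)].
  move=> [_ _ [g [gK ag]]] FN.
  have sgF : smooth_map (g \o F) := smooth_map_analytic_comp sF FN ag.
  have gP t : triples A B C (g (F t)) /\ triple_mul (g (F t)) = F t.
    by have [p tp pF] := FN t; rewrite -pF gK.
  have slin (K : normedModType R)
      (L : {linear (wiener nu * wiener nu * wiener nu)%type -> K}) :
      continuous L -> smooth_map (L \o (g \o F)).
    move=> cL i k; apply: (@Ck_comp _ _ _ _ _ _ setT _ L) (sgF i k) _ => //.
      exact: m_open_image.
    by apply: Ck_lin => //; exact: openT.
  exists (fun t => (g (F t)).1.1), (fun t => (g (F t)).1.2), (fun t => (g (F t)).2).
  split.
  - split; last by move=> t; have [[[]]] := gP t.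
    apply: (slin _ (fst \o fst)) => p.
    by apply: continuous_comp; exact: cfst.
  - split; last by move=> t; have [[[]]] := gP t.
    apply: (slin _ (snd \o fst)) => p.
    by apply: continuous_comp; [exact: cfst|exact: csnd].
  - split; last by move=> t; have [[_]] := gP t.
    by apply: (slin _ snd); exact: csnd.
  - by move=> t; have [_ {1}<-] := gP t.
have [Fp [F0 [Fn [[sFp hFp] [sF0 hF0] [sFn hFn] FE]]]] :=
  split3 _ _ _ RBd (fun t => (hFB t).2).
have [Gm [G0 [Gn [[sGm hGm] [sG0 hG0] [sGn hGn] GE]]]] :=
  split3 _ _ _ LBd (fun t => (hFB t).1).
(* The middle factors extend to both discs, so they can be absorbed into the unnormalized factor on
   either side. *)
pose Fm t := loop_mul (F0 t) (Fn t); pose Gp t := loop_mul (G0 t) (Gn t).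
have FpFm t : F t = loop_mul (Fp t) (Fm t) by rewrite FE loop_mulA.
have GmGp t : F t = loop_mul (Gm t) (Gp t) by rewrite GE loop_mulA.
have HFm t : (H `&` LambdaM G) (Fm t).
  have [h1 _ h2] := constS _ (hF0 t); have [h3 /M1M h4] := minusS _ (hFn t).
  by split; [exact: HM|exact: LambdaM_mul].
have HGp t : (H `&` LambdaP G) (Gp t).
  have [h1 h2 _] := constS _ (hG0 t); have [h3 /LambdaP1P h4] := plusS _ (hGn t).
  by split; [exact: HM|exact: LambdaP_mul].
have sFm : smooth_map Fm by exact: smooth_map_mul.
have sGp : smooth_map Gp by exact: smooth_map_mul.
have pFp : plus_map Fp.
  split => // t; have [h1 h2] := plusS _ (hFp t).
    exact: LambdaP_vanish (LambdaP1P h2).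
  by have [q hq] := inv _ h1; exists q => //; exact: invP (LambdaP1P h2) hq.
have Fp0 t : Fp t 0 = 1 by have [_] := plusS _ (hFp t); exact: LambdaP1_coef0.
have mGm : minus_map Gm.
  split => // t; have [h1 h2] := minusS _ (hGm t); first exact/vM/M1M.
  by have [q hq] := inv _ h1; exists q => //; exact: invM (M1M _ h2) hq.
have Gm0 t : Gm t 0 = 1 by have [_] := minusS _ (hGm t); exact: M10.
have mFm : minus_map Fm.
  split => // t; have [h1 h2] := HFm t; first exact: vM.
  by have [q hq] := inv _ h1; exists q => //; exact: invM h2 hq.
have pGp : plus_map Gp.
  split => // t; have [h1 h2] := HGp t; first exact: LambdaP_vanish h2.
  by have [q hq] := inv _ h1; exists q => //; exact: invP h2 hq.
have pair : normalized_pair G H a b Gm Fp.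
  split.
  - split; last exact: minus_factor_order ha mGm Gm0 pGp GmGp oF.
    by split => // t; have [] := minusS _ (hGm t).
  - split; last exact: plus_factor_order hb pFp Fp0 mFm FpFm oF.
    by split => // t; have [] := plusS _ (hFp t).
  - by move=> t; exact: minusS.
  - by move=> t; exact: plusS.
have fact : birkhoff_factors G H F Gm Gp Fp Fm by [].
exists (Gm, Fp); split; first by split => //; exists Fm, Gp.
move=> [Gm' Fp'] /= [pair' [Fm' [Gp' fact']]].
by have [-> ->] := uniq _ _ _ _ _ _ _ _ pair fact pair' fact'.
Qed.
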